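(* Let $R$ be a ring. The abstract elementary class $({}_R\mathrm{Mod}, \leq_{Emb})$ of left $R$-modules with embeddings is superstable if and only if $R$ is left noetherian.
   Context: Rings are associative with unity; ${}_R\mathrm{Mod}$ is the class of left $R$-modules, $A \leq_{Emb} B$ means that $A$ is a submodule of $B$; $\|A\|$ is the cardinality of $A$. A ring is left noetherian if direct sums of injective left modules are injective (equivalently, it has the ascending chain condition on left ideals). For an abstract elementary class $\mathbf{K} = (K, \leq)$ of modules with L\''owenheim-Skolem number $\operatorname{LS}(\mathbf{K})$ (here $\operatorname{card}(R) + \aleph_0$), a $\mathbf{K}$-embedding is an injective homomorphism $f: M \to N$ with $M, N \in K$ and $f[M] \leq N$. For $N \leq M$ with $\|N\| = \|M\| = \lambda$, $M$ is universal over $N$ if for every $N^* \in K$ with $N \leq N^*$ and $\|N^*\| \leq \lambda$ there is a $\mathbf{K}$-embedding $N^* \to M$ which is the identity on $N$. For an infinite cardinal $\lambda$, $M$ is a $\lambda$-limit model if there are a limit ordinal $\alpha < \lambda^+$ and a $\leq$-increasing continuous chain $\{M_i : i < \alpha\}$ of members of $K$ of cardinality $\lambda$ with $M = \bigcup_{i<\alpha} M_i$ and $M_{i+1}$ universal over $M_i$ for each $i < \alpha$. $\mathbf{K}$ is superstable if there is a cardinal $\mu \geq \operatorname{LS}(\mathbf{K})$ such that for every $\lambda \geq \mu$ there is a $\lambda$-limit model and it is unique up to isomorphism. *)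

(* Defs.v *)
From HB Require Import structures.
From mathcomp Require Import all_boot all_algebra.
From mathcomp Require Import boolp wochoice classical_sets functions.
From mathcomp Require Import cardinality.

Set Implicit Arguments.
Unset Strict Implicit.
Unset Printing Implicit Defensive.

Import GRing.Theory.

Local Open Scope ring_scope.
Local Open Scope classical_set_scope.
Local Open Scope card_scope.

(* Submodules are the library's [submodClosed M]; [submod A] is the submodule *)
(* A as a module in its own right.                                            *)
Section Submodule.
Context (R : nzRingType) (M : lmodType R) (A : submodClosed M).

Record submod := Submod { submod_val : M; submod_valP : submod_val \in A }.

HB.instance Definition _ := [isSub for submod_val].
HB.instance Definition _ := [Choice of submod by <:].
HB.instance Definition _ := [SubChoice_isSubLmodule of submod by <:].

End Submodule.

Section FullSubmodule.
Context (R : nzRingType) (M : lmodType R).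

Definition full_pred : {pred M} := predT.

Fact full_pred_closed : submod_closed full_pred.
Proof. by []. Qed.

HB.instance Definition _ :=
  GRing.isSubmodClosed.Build R M full_pred
    (GRing.submod_closed_semi full_pred_closed).

Definition full_submod : submodClosed M := full_pred.

End FullSubmodule.

Section ImageSubmodule.
Context (R : nzRingType) (M N : lmodType R) (f : {linear M -> N}).

Definition image_pred : {pred N} := fun y => `[< range f y >].

Fact image_pred_closed : submod_closed image_pred.
Proof.
split=> [|a u v /asboolP[x _ <-] /asboolP[y _ <-]]; apply/asboolP.
  by exists 0; rewrite ?linear0.
by exists (a *: x + y); rewrite ?linearP.
Qed.

HB.instance Definition _ :=
  GRing.isSubmodClosed.Build R N image_pred
    (GRing.submod_closed_semi image_pred_closed).

Definition image_submod : submodClosed N := image_pred.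

End ImageSubmodule.

Section DirectSum.
Context (R : nzRingType) (I : Type) (E : I -> lmodType R).

Local Notation dfunext := functional_extensionality_dep.

Definition dprod : Type := forall i, E i.

HB.instance Definition _ := Choice.on dprod.

Definition dprod_zero : dprod := fun=> 0.
Definition dprod_opp (f : dprod) : dprod := fun i => - f i.
Definition dprod_add (f g : dprod) : dprod := fun i => f i + g i.
Definition dprod_scale (a : R) (f : dprod) : dprod := fun i => a *: f i.

Fact dprod_addA : associative dprod_add.
Proof. by move=> f g h; apply: dfunext => i; exact: addrA. Qed.

Fact dprod_addC : commutative dprod_add.
Proof. by move=> f g; apply: dfunext => i; exact: addrC. Qed.

Fact dprod_add0r : left_id dprod_zero dprod_add.
Proof. by move=> f; apply: dfunext => i; exact: add0r. Qed.

Fact dprod_addNr : left_inverse dprod_zero dprod_opp dprod_add.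
Proof. by move=> f; apply: dfunext => i; exact: addNr. Qed.

HB.instance Definition _ :=
  GRing.isZmodule.Build dprod dprod_addA dprod_addC dprod_add0r dprod_addNr.

Fact dprod_scaleA a b f :
  dprod_scale a (dprod_scale b f) = dprod_scale (a * b) f.
Proof. by apply: dfunext => i; exact: scalerA. Qed.

Fact dprod_scale1 : left_id 1 dprod_scale.
Proof. by move=> f; apply: dfunext => i; exact: scale1r. Qed.

Fact dprod_scaleDr : right_distributive dprod_scale +%R.
Proof. by move=> a f g; apply: dfunext => i; exact: scalerDr. Qed.

Fact dprod_scaleDl f : {morph dprod_scale^~ f : a b / a + b}.
Proof. by move=> a b; apply: dfunext => i; exact: scalerDl. Qed.

HB.instance Definition _ := GRing.Zmodule_isLmodule.Build R dprod
  dprod_scaleA dprod_scale1 dprod_scaleDr dprod_scaleDl.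

Definition fin_supp : {pred dprod} :=
  fun f => `[< finite_set [set i | f i != 0] >].

Fact fin_supp_closed : submod_closed fin_supp.
Proof.
split=> [|a f g /asboolP ff /asboolP fg]; apply/asboolP.
  rewrite (_ : [set _ | _] = set0) ?finite_set0// -subset0.
  by move=> i /=; rewrite eqxx.
apply: (@sub_finite_set _ _ ([set i | f i != 0] `|` [set i | g i != 0])).
  move=> i fgi; have {}fgi : a *: f i + g i != 0 := fgi.
  have [fi0|fi0] := eqVneq (f i) 0; last by left.
  by right => /=; move: fgi; rewrite fi0 scaler0 add0r.
by rewrite finite_setU.
Qed.

HB.instance Definition _ := GRing.isSubmodClosed.Build R dprod fin_supp
  (GRing.submod_closed_semi fin_supp_closed).

Definition direct_sum : lmodType R := submod fin_supp.

End DirectSum.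

Section Noetherian.
Variable R : nzRingType.

Definition injective_module (E : lmodType R) :=
  forall (A B : lmodType R) (i : {linear A -> B}) (f : {linear A -> E}),
    injective i -> exists g : {linear B -> E}, forall a, g (i a) = f a.

Definition left_noetherian :=
  forall (I : Type) (E : I -> lmodType R),
    (forall i, injective_module (E i)) -> injective_module (direct_sum E).

End Noetherian.

(* A cardinal is represented by any type of that cardinality. All cardinals   *)
(* (and index types of chains) share the universe of this one constant, which *)
(* [module_of_large_card] keeps below the universe of modules, so that        *)
(* "every cardinal" does not outrun "every module".                           *)
Definition cardinal := Type.

Lemma module_of_large_card (R : nzRingType) (L : cardinal) :
  exists M : lmodType R, [set: L] #<= [set: M].
Proof.
pose f (x y : L) : R^o := if `[< x = y >] then 1 else 0.
exists (L -> R^o : lmodType R).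
suff /injfunPex[g] : exists2 g : L -> L -> R^o,
    set_fun [set: L] [set: L -> R^o] g & set_inj [set: L] g.
  exact: inj_card_le g.
exists f => // x y _ _ /(congr1 (@^~ x)); rewrite /f.
by case: asboolP => // _; case: asboolP => // _ /eqP; rewrite oner_eq0.
Qed.

(* A class of modules with a relation "A is a strong submodule of B" between  *)
(* submodules of a common module.                                             *)
Record module_class (R : nzRingType) := ModuleClass {
  in_class : lmodType R -> Prop;
  strong_sub : forall M : lmodType R, submodClosed M -> submodClosed M -> Prop
}.

Definition RMod_Emb (R : nzRingType) : module_class R :=
  {| in_class := fun=> True;
     strong_sub := fun M A B => {subset A <= B} |}.

Section ClassNotions.
Variables (R : nzRingType) (K : module_class R).

Definition K_embedding (M N : lmodType R) (f : {linear M -> N}) :=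
  [/\ in_class K M, in_class K N, injective f &
      strong_sub K (image_submod f) (full_submod N)].

(* An extension N* of A is given, up to isomorphism, by a K-embedding g of A  *)
(* into N*; "identity on A" then becomes h \o g = inclusion.                  *)
Definition universal_over (M : lmodType R) (A B : submodClosed M) :=
  forall (Nstar : lmodType R) (g : {linear submod A -> Nstar}),
    K_embedding g -> [set: Nstar] #<= [set: submod A] ->
    exists h : {linear Nstar -> submod B},
      K_embedding h /\ forall a, val (h (g a)) = val a.

Definition olt (I : Type) (r : rel I) i j := r i j /\ i <> j.

Definition is_succ (I : Type) (r : rel I) i j :=
  olt r i j /\ forall k, olt r i k -> r j k.

Definition is_limit (I : Type) (r : rel I) i :=
  (exists j, olt r j i) /\ forall j, ~ is_succ r j i.

Definition limit_order (I : Type) (r : rel I) :=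
  [/\ well_order r, inhabited I & forall i, exists j, olt r i j].

(* (I, r) has order type a limit ordinal alpha; alpha < lambda^+ amounts to   *)
(* #|I| <= lambda.                                                            *)
Definition limit_model (L : cardinal) (M : lmodType R) :=
  [/\ infinite_set [set: L], in_class K M &
  exists (I : cardinal) (r : rel I) (S : I -> submodClosed M),
    [/\ limit_order r, [set: I] #<= [set: L] &
     [/\ forall i, in_class K (submod (S i)) /\ [set: submod (S i)] #= [set: L],
         forall i j, r i j -> strong_sub K (S i) (S j),
         forall i, is_limit r i ->
           [set` S i] = \bigcup_(j in [set j | olt r j i]) [set` S j],
         [set: M] = \bigcup_i [set` S i] &
         forall i j, is_succ r i j -> universal_over (S i) (S j)]]].

Definition isomorphic (M N : lmodType R) :=
  exists f : {linear M -> N}, bijective f.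

(* The type R + nat has cardinality LS(K) = card(R) + aleph_0.                *)
Definition superstable :=
  exists mu : cardinal, [set: (R + nat)%type] #<= [set: mu] /\
    forall L : cardinal, [set: mu] #<= [set: L] ->
      (exists M : lmodType R, limit_model L M) /\
      forall M N : lmodType R,
        limit_model L M -> limit_model L N -> isomorphic M N.

End ClassNotions.

(* Main.v *)
Require Import Defs.
From HB Require Import structures.
From mathcomp Require Import all_boot all_order all_algebra.
From mathcomp Require Import boolp wochoice classical_sets functions.
From mathcomp Require Import cardinality generic_quotient ring_quotient.

(** Everything rests on an injective module [N] of a given infinite size [L] in
which all the quotients of modules of size at most [L] embed
([universal_injective]). Suppose that [(I, r)] is a well-order without maximum
and that the functions from [I] to [N] with support below a given index are at
most [L] in number. Then the functions with bounded support form a limit model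
with a chain indexed by [I], the members being the functions with support below
an index ([bounded_limit_model]). Indeed, if [P] extends the functions [S i]
with support below [i], then the coordinates of [S i] extend to [P] because [N]
is injective, and one more coordinate embeds [P / S i] in [N]. Such modules [N]
consist of functions from [L] to a fixed injective module [cogen R] that has an
element with annihilator [J] for every left ideal [J]; the restriction on their
supports keeps the size equal to [L] ([supported_universal]).

Let [R] be left noetherian. For every large [L] the direct sum [N] of [L] copies
of [cogen R] is injective, which provides a limit model indexed by [nat]. Chains
of left ideals stabilize ([chain_stabilizes], the argument of Bass and Papp), so
that Baer's criterion makes every limit model injective
([limit_model_injective]). Two limit models of size [L] embed in each other, and
injective modules that embed in each other are isomorphic
([injective_schroeder_bernstein], a theorem of Bumby).

Conversely, assume superstability. Choose [L] large with [L ^ K = L], where [K]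
is [R + nat], and let [N] consist of the functions with support of size at most
[K], which is injective by Baer's criterion. Besides the limit model of finite
functions from [nat] to [N] there is a limit model indexed by a well-order in
which every family indexed by [R] is bounded ([long_order]); the latter is
injective, again by Baer's criterion, because a map from a left ideal only
involves a bounded set of coordinates. By uniqueness the former is injective too
([short_limit_model_injective]). Any countable direct sum of injective modules
of size at most [L] is a retract of it, and arbitrary direct sums reduce to
countable ones ([superstable_noetherian]). *)

Set Implicit Arguments.
Unset Strict Implicit.
Unset Printing Implicit Defensive.

Import Order.TTheory GRing.Theory Num.Theory.

Local Open Scope ring_scope.
Local Open Scope classical_set_scope.
Local Open Scope card_scope.

(** * Linear relations and injective modules *)

(** Unions of nonempty chains suffice, as [A0] takes care of the empty one. *)
Lemma zorn_set T (P : set (set T)) (A0 : set T) : P A0 ->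
  (forall F : set (set T), F !=set0 -> F `<=` P -> total_on F subset ->
     P (\bigcup_(X in F) X)) ->
  exists A, P A /\ forall B, A `<=` B -> P B -> B `<=` A.
Proof.
move=> PA0 Pcup.
have [F FQ Ftot|A [QA Amax]] := @Zorn_bigcup T [set X | X = set0 \/ P X].
  have [[X FX PX]|noP] := pselect (exists2 X, F X & P X); last first.
    left; rewrite -subset0 => x [X FX Xx].
    have [X0|PX] := FQ _ FX; first by rewrite X0 in Xx.
    by case: noP; exists X.
  right; rewrite (_ : \bigcup_(X in F) X = \bigcup_(X in F `&` P) X).
    apply: Pcup => [|Y []//|Y Z [FY _] [FZ _]]; first by exists X.
    exact: Ftot.
  apply/seteqP; split=> [x [Y FY Yx]|x [Y [FY _] Yx]]; last by exists Y.
  have [Y0|PY] := FQ _ FY; first by rewrite Y0 in Yx.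
  by exists Y.
have maxA B : A `<=` B -> P B -> B `<=` A.
  move=> AB PB; apply: contrapT => nBA; by apply: (Amax B); [split | right].
case: QA => [A_0|PA]; last by exists A.
exists A; split=> //; rewrite (_ : A = A0) //; apply/seteqP.
by split; [rewrite A_0 | apply: maxA => //; rewrite A_0].
Qed.

Section IsSubmodule.
Context (R : nzRingType) (M : lmodType R).

Definition is_submodule (A : set M) :=
  A 0 /\ forall a u v, A u -> A v -> A (a *: u + v).

Section Closure.
Context (A : set M) (subA : is_submodule A).

Lemma is_submodule0 : A 0. Proof. by case: subA. Qed.

Lemma is_submoduleD u v : A u -> A v -> A (u + v).
Proof. by case: subA => _ AP Au /(AP 1 _ _ Au); rewrite scale1r. Qed.

Lemma is_submoduleZ a u : A u -> A (a *: u).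
Proof. by case: subA => A0 AP /(AP a)/(_ A0); rewrite addr0. Qed.

Lemma is_submoduleB u v : A u -> A v -> A (u - v).
Proof. by move=> Au Av; rewrite -scaleN1r; apply/is_submoduleD/is_submoduleZ. Qed.

(** The proof argument makes the closure properties available to instance
inference. *)
Definition submodule_pred of is_submodule A : {pred M} := fun x => `[< A x >].

Fact submodule_pred_closed : submod_closed (submodule_pred subA).
Proof.
split=> [|a u v /asboolP Au /asboolP Av]; apply/asboolP.
  by case: subA.
by apply: (proj2 subA).
Qed.

HB.instance Definition _ := GRing.isSubmodClosed.Build R M (submodule_pred subA)
  (GRing.submod_closed_semi submodule_pred_closed).

Definition to_submod : submodClosed M := submodule_pred subA.

End Closure.

Lemma bigcup_submodule (F : set (set M)) : F !=set0 ->
  F `<=` is_submodule -> total_on F subset ->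
  is_submodule (\bigcup_(X in F) X).
Proof.
move=> [X FX] Fsub Ftot; split=> [|a u v [Y FY Yu] [Z FZ Zv]].
  by exists X => //; exact: is_submodule0 (Fsub _ FX).
have [YZ|ZY] := Ftot _ _ FY FZ.
  by exists Z => //; apply: (proj2 (Fsub _ FZ)) => //; exact: YZ.
by exists Y => //; apply: (proj2 (Fsub _ FY)) => //; exact: ZY.
Qed.

End IsSubmodule.

Lemma linear_of_fun (R : nzRingType) (A B : lmodType R) (f : A -> B) :
  linear f -> exists g : {linear A -> B}, g =1 f.
Proof.
move=> linf.
pose g := HB.pack_for {linear A -> B} f (GRing.isLinear.Build R A B *:%R f linf).
by exists g.
Qed.

Section LinearRelation.
Context (R : nzRingType) (A E : lmodType R).
Implicit Types H : set (A * E).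

Definition functional H := forall n, H (0, n) -> n = 0.

Lemma functional_inj H a n n' : is_submodule H -> functional H ->
  H (a, n) -> H (a, n') -> n = n'.
Proof.
move=> subH funH Hn Hn'; apply/eqP; rewrite -subr_eq0; apply/eqP/funH.
by have := is_submoduleB subH Hn Hn'; rewrite /= -[(a, n) - _]/(_, _) subrr.
Qed.

Lemma total_functional H : is_submodule H -> functional H ->
  (forall a, exists n, H (a, n)) ->
  exists g : {linear A -> E}, forall a, H (a, g a).
Proof.
move=> subH funH /choice[f Hf].
have [a u v|g gf] := @linear_of_fun R A E f; last by exists g => a; rewrite gf.
apply: (functional_inj subH funH (Hf _)).
by have := proj2 subH a _ _ (Hf u) (Hf v).
Qed.

Definition adjoin H (p : A * E) : set (A * E) :=
  [set q | exists h r, H h /\ q = h + r *: p].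

Lemma sub_adjoin H p : H `<=` adjoin H p.
Proof. by move=> h Hh; exists h, 0; rewrite scale0r addr0. Qed.

Lemma adjoin_mem H p : is_submodule H -> adjoin H p p.
Proof. by case=> H0 _; exists 0, 1; rewrite scale1r add0r. Qed.

Lemma adjoin_submodule H p : is_submodule H -> is_submodule (adjoin H p).
Proof.
move=> subH; split=> [|a _ _ [h [r [Hh ->]]] [k [s [Hk ->]]]].
  exact: sub_adjoin (is_submodule0 subH).
exists (a *: h + k), (a * r + s); split; first exact: (proj2 subH).
by rewrite scalerDr scalerDl scalerA addrACA.
Qed.

(** If [r *: y] lies in the domain of [H] only when its value there is
[r *: u], then [u] is a consistent value at [y]. *)
Lemma adjoin_functional H y u : is_submodule H -> functional H ->
  (forall r n, H (r *: y, n) -> n = r *: u) -> functional (adjoin H (y, u)).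
Proof.
move=> subH funH Hy n [[b m] [r [Hbm [bE nE]]]].
have {}bE : b = (- r) *: y by apply/eqP; rewrite scaleNr -addr_eq0 -bE.
by rewrite bE in Hbm; rewrite nE (Hy _ _ Hbm) scaleNr addNr.
Qed.

End LinearRelation.

Section Injective.
Context (R : nzRingType).

(** Injectivity without subobjects: partial linear maps, encoded by their
graphs, extend to the whole module. *)
Lemma injective_extend (E : lmodType R) : injective_module E ->
  forall (A : lmodType R) (H : set (A * E)), is_submodule H -> functional H ->
  exists g : {linear A -> E}, forall a n, H (a, n) -> g a = n.
Proof.
move=> injE A H subH funH.
have subD : is_submodule [set a | exists n, H (a, n)].
  split=> [|a u v [m Hm] [n Hn]]; first by exists 0; exact: (is_submodule0 subH).
  by exists (a *: m + n); exact: (proj2 subH a _ _ Hm Hn).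
pose D : lmodType R := submod (to_submod subD).
have [f fP] : {f : D -> E & forall d, H (val d, f d)}.
  by apply: (@choice D E (fun d n => H (val d, n))) => -[d dD]; apply/asboolP.
have [a u v|f' f'E] := @linear_of_fun R D E f.
  apply: (functional_inj subH funH (fP _)).
  exact: (proj2 subH a _ _ (fP u) (fP v)).
have [g gP] := injE D A (val : {linear D -> A}) f' val_inj.
exists g => a n Han.
have aD : a \in to_submod subD by apply/asboolP; exists n.
have := gP (Submod aD); rewrite f'E /= => ->.
have fa := fP (Submod aD); exact: (functional_inj subH funH fa Han).
Qed.

(** Baer's criterion. A maximal partial extension of [f] along [i] is total:
if [b] were outside its domain, then the scalars [r] with [r *: b] in the
domain would form a left ideal, the element provided for that ideal would be a
consistent value at [b], and the extension could be enlarged. *)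
Lemma baer (E : lmodType R) :
  (forall H : set (R^o * E), is_submodule H -> functional H ->
    exists x, forall r n, H (r, n) -> n = r *: x) ->
  injective_module E.
Proof.
move=> baerE A B i f injI.
pose H0 := [set (i a, f a) | a in setT].
pose P (H : set (B * E)) := [/\ is_submodule H, functional H & H0 `<=` H].
have PH0 : P H0.
  split=> //.
    split=> [|a _ _ [u _ <-] [v _ <-]]; first by exists 0; rewrite ?linear0.
    by exists (a *: u + v); rewrite ?linearP.
  by move=> _ [a _ [ia <-]]; rewrite (injI a 0) ?linear0.
have [F [X FX] FP Ftot|H [[subH funH H0H] Hmax]] := zorn_set PH0.
  split.
  - by apply: bigcup_submodule => // [|Y /FP[]//]; exists X.
  - by move=> n [Y /FP[_ funY _]]; exact: funY.
  - by move=> p H0p; exists X => //; have [_ _] := FP _ FX; exact.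
have [g gP] : exists g : {linear B -> E}, forall b, H (b, g b).
  apply: total_functional => // b.
  pose J := [set p : R^o * E | H (p.1 *: b, p.2)].
  have [| |x xP] := baerE J.
  - split=> [|a u v Ju Jv].
      by rewrite /J/= scale0r; exact: (is_submodule0 subH).
    have := proj2 subH a _ _ Ju Jv; rewrite /J /= -[a *: _ + _]/(_, _) /=.
    by rewrite scalerA -scalerDl.
  - by move=> n; rewrite /J/= scale0r; exact: funH.
  exists x; apply: (Hmax _ (@sub_adjoin _ _ _ H (b, x)) _ _ (adjoin_mem _ subH)).
  split; [exact: adjoin_submodule| |].
    by apply: adjoin_functional => // r n; exact: xP.
  exact/(subset_trans H0H)/sub_adjoin.
exists g => a; apply: (functional_inj subH funH (gP _)).
by apply: H0H; exists a.
Qed.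

Definition dproj (I : Type) (E : I -> lmodType R) i (x : dprod E) : E i := x i.

Fact dproj_linear I (E : I -> lmodType R) i : linear (@dproj I E i).
Proof. by []. Qed.

HB.instance Definition _ I (E : I -> lmodType R) i :=
  GRing.isLinear.Build R (dprod E) (E i) *:%R (@dproj I E i)
    (@dproj_linear I E i).

Definition dprod_map (I : Type) (E : I -> lmodType R) (B : lmodType R)
  (g : forall i, {linear B -> E i}) (b : B) : dprod E := fun i => g i b.

Fact dprod_map_linear I (E : I -> lmodType R) (B : lmodType R)
  (g : forall i, {linear B -> E i}) : linear (dprod_map g).
Proof.
by move=> a u v; apply: functional_extensionality_dep => i; exact: linearP.
Qed.

HB.instance Definition _ I (E : I -> lmodType R) (B : lmodType R)
    (g : forall i, {linear B -> E i}) :=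
  GRing.isLinear.Build R B (dprod E) *:%R (dprod_map g) (dprod_map_linear g).

Lemma injective_dprod (I : Type) (E : I -> lmodType R) :
  (forall i, injective_module (E i)) -> injective_module (dprod E).
Proof.
move=> injE A B i f injI.
have g k := cid (injE k A B i (@dproj I E k \o f) injI).
exists (dprod_map (fun k => sval (g k))) => a.
apply: functional_extensionality_dep => k.
by have := svalP (g k) a.
Qed.

Lemma injective_retract (E F : lmodType R) (s : {linear E -> F})
    (p : {linear F -> E}) : cancel s p -> injective_module F ->
  injective_module E.
Proof.
move=> sK injF A B i f injI; have [g gP] := injF A B i (s \o f) injI.
by exists (p \o g) => a /=; rewrite gP /= sK.
Qed.

Lemma injective_section (E F : lmodType R) (s : {linear E -> F}) :
  injective_module E -> injective s -> exists p : {linear F -> E}, cancel s p.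
Proof. by move=> injE injs; apply: (injE E F s idfun injs). Qed.

End Injective.

(** * An injective module with elements of every annihilator *)

(** The left ideals of [int] are principal, so Baer's criterion reduces
injectivity over [int] to divisibility. *)
Lemma divisible_injective (D : lmodType int) :
  (forall (n : nat) (d : D), (0 < n)%N -> exists x, d = n%:Z *: x) ->
  injective_module D.
Proof.
move=> divD; apply: baer => H subH funH.
have [[n [n_gt0 [d Hd]]]|noH] :=
  pselect (exists n : nat, (0 < n)%N /\ exists d, H (n%:Z, d)); last first.
  exists 0 => r n Hr; rewrite scaler0; apply: funH.
  have [r0|r_neq0] := eqVneq r 0; first by rewrite -[X in H (X, _)]r0.
  case: noH; exists `|r|%N; split; first by rewrite absz_gt0.
  case: (ltrP 0 r) => [r_gt0|r_le0]; first by exists n; rewrite gtz0_abs.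
  exists (- n); rewrite lez0_abs //.
  by have := is_submoduleZ subH (-1) Hr; rewrite scaleN1r.
pose P m := (0 < m)%N && `[< exists d, H (m%:Z, d) >].
have exP : exists m, P m by exists n; rewrite /P n_gt0; apply/asboolP; exists d.
case: (ex_minnP exP) => m /andP[m_gt0 /asboolP[e He]] m_min.
have [x ex] := divD m e m_gt0; exists x => r k Hr.
have rE := divz_eq r m.
set q := (r %/ m)%Z in rE; set s := (r %% m)%Z in rE.
have Hs : H (s, k - q *: e).
  have := is_submoduleB subH Hr (is_submoduleZ subH q He).
  rewrite -[(r, k) - _]/(_, _) /= -[q *: (m%:Z : int^o)]/(q * m%:Z).
  by rewrite {1}rE [_ + s]addrC addrK.
have m0 : m%:Z != 0 by rewrite eqz_nat -lt0n.
have s_ge0 : 0 <= s by exact: modz_ge0.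
have s0 : s = 0.
  apply: contrapT => /eqP s_neq0.
  have : (`|s| < m)%N by rewrite -ltz_nat gez0_abs // ltz_pmod.
  rewrite ltnNge m_min // /P absz_gt0 s_neq0; apply/asboolP.
  by exists (k - q *: e); rewrite gez0_abs.
have /eqP : k - q *: e = 0 by apply: funH; rewrite -s0.
by rewrite subr_eq0 => /eqP ->; rewrite ex scalerA rE s0 addr0.
Qed.

Section RationalsModIntegers.

Definition int_rat : {pred rat} := fun x => `[< exists z : int, x = z%:~R >].

Fact int_rat_closed : zmod_closed int_rat.
Proof.
split=> [|x y /asboolP[z ->] /asboolP[t ->]]; apply/asboolP.
  by exists 0.
by exists (z - t); rewrite rmorphB.
Qed.

HB.instance Definition _ := GRing.isZmodClosed.Build rat int_rat int_rat_closed.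

Definition QZ : lmodType int := zmodule (Quotient.quot int_rat).

Definition QZpi (x : rat) : QZ := (\pi_(Quotient.quot int_rat) x)%qT.

Lemma QZpi_eq0 x : QZpi x = 0 <-> exists z : int, x = z%:~R.
Proof.
have xE : (x \in int_rat) = (QZpi x == 0).
  by rewrite -[in LHS](subr0 x) Quotient.idealrBE raddf0.
split=> [/eqP|xZ]; first by rewrite -xE => /asboolP.
by apply/eqP; rewrite -xE; apply/asboolP.
Qed.

Lemma QZpi_surj d : exists x, d = QZpi x.
Proof. by exists (repr (d : Quotient.quot int_rat)); rewrite /QZpi reprK. Qed.

Lemma QZpiZ (n : int) x : n *: QZpi x = QZpi (x *~ n).
Proof. by rewrite /QZpi raddfMz. Qed.

Lemma QZ_injective : injective_module QZ.
Proof.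
apply: divisible_injective => n d n_gt0; have [x ->] := QZpi_surj d.
exists (QZpi (x / n%:R)); rewrite QZpiZ -mulrzl -pmulrn mulrC divfK //.
by rewrite pnatr_eq0 -lt0n.
Qed.

End RationalsModIntegers.
Section CharacterModule.
Context (R : nzRingType).

Definition additive_fun : set (dprod (fun _ : R => QZ)) :=
  [set c | forall s t, c (s + t) = c s + c t].

Fact additive_fun_submodule : is_submodule additive_fun.
Proof.
split=> [s t|a c d addc addd s t]; first by rewrite -[LHS]/0 -[RHS]/(0 + 0) addr0.
rewrite -[LHS]/(a *: c (s + t) + d (s + t)).
rewrite -[RHS]/((a *: c s + d s) + (a *: c t + d t)).
by rewrite addc addd scalerDr addrACA.
Qed.

(** The character module: the additive maps from [R] to [QZ], on which [R] acts
by right translation of the argument. *)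
Definition char : Type := submod (to_submod additive_fun_submodule).

HB.instance Definition _ := GRing.Zmodule.on char.

Definition char_fun (c : char) : R -> QZ := val c.

Lemma char_funD c s t : char_fun c (s + t) = char_fun c s + char_fun c t.
Proof. by case: c => c cP; have /asboolP := cP; exact. Qed.

Lemma charP c d : char_fun c =1 char_fun d -> c = d.
Proof.
by move=> cd; apply/val_inj/functional_extensionality_dep; exact: cd.
Qed.

Lemma char_of (f : R -> QZ) : (forall s t, f (s + t) = f s + f t) ->
  {c : char | char_fun c =1 f}.
Proof.
move=> addf; have fA : (f : dprod (fun _ => QZ)) \in
  to_submod additive_fun_submodule by exact/asboolP.
by exists (Submod fA).
Qed.

Fact char_scale_subproof (r : R) (c : char) :
  {d : char | char_fun d =1 fun s => char_fun c (s * r)}.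
Proof. by apply: char_of => s t; rewrite mulrDl char_funD. Qed.

Definition char_scale r c : char := sval (char_scale_subproof r c).

Lemma char_scaleE r c s : char_fun (char_scale r c) s = char_fun c (s * r).
Proof. exact: (svalP (char_scale_subproof r c)). Qed.

Fact char_scaleA a b c : char_scale a (char_scale b c) = char_scale (a * b) c.
Proof. by apply: charP => s; rewrite !char_scaleE mulrA. Qed.

Fact char_scale1 : left_id 1 char_scale.
Proof. by move=> c; apply: charP => s; rewrite char_scaleE mulr1. Qed.

Fact char_scaleDr : right_distributive char_scale +%R.
Proof.
move=> a c d; apply: charP => s.
by rewrite -[RHS]/(char_fun (char_scale a c) s + char_fun (char_scale a d) s)
  !char_scaleE.
Qed.

Fact char_scaleDl c : {morph char_scale^~ c : a b / a + b}.
Proof.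
move=> a b; apply: charP => s.
rewrite -[RHS]/(char_fun (char_scale a c) s + char_fun (char_scale b c) s).
by rewrite !char_scaleE mulrDr char_funD.
Qed.

HB.instance Definition _ := GRing.Zmodule_isLmodule.Build R char
  char_scaleA char_scale1 char_scaleDr char_scaleDl.

Lemma int_linear (A B : lmodType int) (f : A -> B) :
  (forall s t, f (s + t) = f s + f t) -> exists g : {linear A -> B}, g =1 f.
Proof.
move=> addf; apply: linear_of_fun => a u v; rewrite addf; congr (_ + _).
have f0 : f 0 = 0 by apply: (addrI (f 0)); rewrite -addf !addr0.
have fN w : f (- w) = - f w.
  by apply/eqP; rewrite -subr_eq0 opprK -addf addNr f0.
have fn n w : f (n%:Z *: w) = n%:Z *: f w.
  elim: n => [|n IHn]; first by rewrite !scale0r.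
  by rewrite intS !scalerDl !scale1r addf IHn.
by case: a => n; rewrite ?NegzE ?scaleNr ?fN fn.
Qed.

(** Evaluation at [1] turns an [R]-linear map into [char] into an additive map
into [QZ]; an additive extension [k] of the latter gives back the [R]-linear
extension [b |-> (s |-> k (s *: b))]. *)
Lemma char_injective : injective_module (char : lmodType R).
Proof.
move=> A B i f injI.
have [s t|i' i'E] := @int_linear (zmodule A) (zmodule B) i; first exact: raddfD.
have [s t|f' f'E] := @int_linear (zmodule A) QZ (fun a => char_fun (f a) 1).
  by rewrite -[s + t]/((s : A) + (t : A)) raddfD.
have [x y|k kE] := QZ_injective f' (i := i').
  by rewrite !i'E; exact: injI.
have addk b : forall s t, k ((s + t) *: (b : B)) = k (s *: b) + k (t *: b).
  move=> s t; rewrite scalerDl.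
  by rewrite -[LHS]/(k ((s *: b : zmodule B) + (t *: b : zmodule B))) raddfD.
pose h b := sval (char_of (addk b)).
have hE b s : char_fun (h b) s = k (s *: b) by exact: (svalP (char_of (addk b))).
have [a u v|g gE] := @linear_of_fun R B char h.
  apply: charP => s.
  rewrite -[RHS]/(char_fun (char_scale a (h u)) s + char_fun (h v) s).
  rewrite char_scaleE !hE scalerDr scalerA.
  exact: raddfD.
exists g => a; rewrite gE; apply: charP => s.
rewrite hE -linearZ -[X in k X]i'E kE f'E linearZ.
by rewrite char_scaleE mul1r.
Qed.

(** The order [n] of [s] modulo [J] (any [n > 1] if the order is infinite) allows
the value [1 / n] at [s] for an additive map that vanishes on [J]. *)
Lemma char_separation (J : set R^o) (s : R) : is_submodule J -> ~ J s ->
  exists c : char, (forall j, J j -> char_fun c j = 0) /\ char_fun c s != 0.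
Proof.
move=> subJ nJs.
have [n [n_gt1 nP]] : exists n : nat,
    (1 < n)%N /\ forall k : int, J (s *~ k) -> (n %| k)%Z.
  have [exn|non] := pselect (exists n : nat, (0 < n)%N && `[< J (s *+ n) >]).
    case: (ex_minnP exn) => n /andP[n_gt0 /asboolP Jn] nmin; exists n; split.
      by case: n n_gt0 Jn {nmin} => [|[]].
    move=> k Jk; have kE := divz_eq k n.
    set q := (k %/ n)%Z in kE; set t := (k %% n)%Z in kE.
    have n0 : n%:Z != 0 by rewrite eqz_nat -lt0n.
    have t_ge0 : 0 <= t by exact: modz_ge0.
    have Jrem (a b : int) : k = a * n%:Z + b -> J (s *~ b).
      move=> kab; have -> : s *~ b = s *~ k - a%:~R * (s *+ n).
        by rewrite kab mulrzDr [a * _]mulrC mulrzA mulrzl addrAC -pmulrn subrr add0r.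
      exact: (is_submoduleB subJ Jk (is_submoduleZ subJ _ Jn)).
    have Jt := Jrem _ _ kE.
    apply/dvdz_mod0P; rewrite -/t; apply: contrapT => /eqP t0.
    have : (`|t| < n)%N by rewrite -ltz_nat gez0_abs // ltz_pmod.
    rewrite ltnNge nmin // absz_gt0 t0; apply/asboolP.
    by rewrite pmulrn gez0_abs.
  exists 2; split=> // k Jk; have [->//|k0] := eqVneq k 0.
  case: non; exists `|k|%N; rewrite absz_gt0 k0; apply/asboolP.
  rewrite pmulrn; case: (ltrP 0 k) => [k_gt0|k_le0]; first by rewrite gtz0_abs.
  by rewrite lez0_abs // mulrNz -mulN1r; exact: (is_submoduleZ subJ).
pose d := QZpi n%:R^-1.
have n0 : n%:R != 0 :> rat by rewrite pnatr_eq0 -lt0n (ltn_trans _ n_gt1).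
have d0 : d != 0.
  apply/eqP => /QZpi_eq0[z zE].
  have : (1 : rat) = (z * n%:Z)%:~R by rewrite rmorphM /= -zE -pmulrn mulVf.
  rewrite -[1]/(1%:~R) => /intr_inj/esym/(congr1 absz); rewrite abszM => /eqP.
  by rewrite muln_eq1 => /andP[_]; rewrite absz_nat => /eqP n1; rewrite n1 in n_gt1.
have kd k : (n %| k)%Z -> k *: d = 0.
  move=> /dvdzP[q ->]; rewrite QZpiZ; apply/QZpi_eq0; exists q.
  by rewrite -mulrzl rmorphM /= -pmulrn mulfK.
pose H0 := [set p : zmodule R * QZ | J p.1 /\ p.2 = 0].
have subH0 : is_submodule H0.
  split=> [|a u v [Ju u0] [Jv v0]]; first by split=> //; exact: (is_submodule0 subJ).
  split; last by rewrite /= u0 v0 scaler0 addr0.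
  apply: (is_submoduleD subJ) => //=; rewrite -[a *: u.1]/((u.1 : R) *~ a).
  by rewrite -mulrzl; exact: (is_submoduleZ subJ).
have funH0 : functional H0 by move=> m [].
have [|k kE] := injective_extend QZ_injective
    (adjoin_submodule (s : zmodule R, d) subH0).
  apply: adjoin_functional => // r m [/= Jr ->].
  by rewrite kd // nP.
have [c cE] := char_of (fun u v => raddfD k u v).
exists c; split=> [j Jj|]; rewrite cE.
  by apply: kE; apply: sub_adjoin; split.
have ks : k s = d := kE _ _ (adjoin_mem _ subH0).
by move: d0; rewrite -ks.
Qed.

End CharacterModule.

Section Cogenerator.
Context (R : nzRingType).

(** The product has one coordinate for each point to be separated from a left
ideal. *)
Definition cogen : lmodType R := dprod (fun _ : R => (char R : lmodType R)).

Lemma cogen_injective : injective_module cogen.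
Proof. by apply: injective_dprod => _; exact: char_injective. Qed.

(** The coordinates of the element separate the points outside [J] from [J]. *)
Lemma cogen_annihilator (J : set R^o) : is_submodule J ->
  exists x : cogen, forall r, r *: x = 0 <-> J r.
Proof.
move=> subJ.
have sep s : exists c : char R,
    (forall j, J j -> char_fun c j = 0) /\ (~ J s -> char_fun c s != 0).
  have [Js|nJs] := pselect (J s); first by exists 0; split.
  by have [c [cJ cs]] := char_separation subJ nJs; exists c.
have [x xP] := choice sep; exists (x : cogen) => r; split=> [rx0|Jr].
  apply: contrapT => /(proj2 (xP r)); apply/negP; rewrite negbK; apply/eqP.
  have := congr1 (fun y : cogen => char_fun (y r) 1) rx0.
  by rewrite -[LHS]/(char_fun (char_scale r (x r)) 1) char_scaleE mul1r.
apply: functional_extensionality_dep => s; apply: charP => t.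
rewrite -[LHS]/(char_fun (char_scale r (x s)) t) char_scaleE.
by rewrite (proj1 (xP s)) //; exact: (is_submoduleZ subJ).
Qed.

End Cogenerator.

(** * Cardinal arithmetic *)

Definition embeds (T U : Type) := exists f : T -> U, injective f.

Lemma card_leTT (T U : Type) : [set: T] #<= [set: U] <-> embeds T U.
Proof.
split=> [/card_leP[f]|[f injf]].
  exists (fun x => val (f (SigSub (in_setT x)))) => x y /val_inj fxy.
  have := 'inj_f (in_setT (SigSub (in_setT x))) (in_setT (SigSub (in_setT y))) fxy.
  by move=> /(congr1 val).
suff /injfunPex[g] : exists2 g : T -> U,
    set_fun [set: T] [set: U] g & set_inj [set: T] g by exact: inj_card_le g.
by exists f => // x y _ _ /injf.
Qed.

Lemma embeds_trans (T U V : Type) : embeds T U -> embeds U V -> embeds T V.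
Proof. by move=> [f injf] [g injg]; exists (g \o f); exact: inj_comp. Qed.

Lemma embeds_prod (T T' U U' : Type) :
  embeds T U -> embeds T' U' -> embeds (T * T') (U * U').
Proof.
move=> [f injf] [g injg]; exists (fun p => (f p.1, g p.2)).
by move=> [x y] [x' y'] /= [/injf -> /injg ->].
Qed.

Lemma embeds_fun (K T U : Type) : embeds T U -> embeds (K -> T) (K -> U).
Proof.
move=> [f injf]; exists (fun h => f \o h) => h h' hh'; apply/funext => k.
by apply: injf; exact: (congr1 (@^~ k) hh').
Qed.

Lemma embeds_inl (T U : Type) : embeds T (T + U).
Proof. by exists inl => x y []. Qed.

Lemma embeds_inr (T U : Type) : embeds U (T + U).
Proof. by exists inr => x y []. Qed.

Lemma infinite_embeds (T : Type) : infinite_set [set: T] <-> embeds nat T.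
Proof. by rewrite infiniteP card_leTT. Qed.

Lemma partial_inverse (T U : Type) (f : T -> U) : injective f ->
  exists g : U -> option T, forall x, g (f x) = Some x.
Proof.
move=> injf; have [|g gP] := @choice U (option T)
    (fun u o => forall x, f x = u -> o = Some x).
  move=> u; have [[x xu]|nou] := pselect (exists x, f x = u).
    by exists (Some x) => y; rewrite -xu => /injf ->.
  by exists None => x xu; case: nou; exists x.
by exists g => x; exact: gP.
Qed.

Lemma chain_common T (F : set (set T)) (X Y : set T) : total_on F subset ->
  F X -> F Y -> exists2 Z, F Z & X `<=` Z /\ Y `<=` Z.
Proof.
move=> Ftot FX FY; have [XY|YX] := Ftot _ _ FX FY.
  by exists Y => //; split=> [|t].
by exists X => //; split=> [t|].
Qed.

(** A maximal partial injection is defined everywhere or surjective. *)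
Lemma embeds_total (T U : Type) : embeds T U \/ embeds U T.
Proof.
pose P (G : set (T * U)) :=
  (forall x y y', G (x, y) -> G (x, y') -> y = y') /\
  (forall x x' y, G (x, y) -> G (x', y) -> x = x').
have [//|F _ FP Ftot|G [[funG injG] Gmax]] := @zorn_set _ P set0.
  split=> [x y y'|x x' y] [X FX Xp] [Y FY Yp].
    have [Z /FP[funZ _] [XZ YZ]] := chain_common Ftot FX FY.
    exact: funZ (XZ _ Xp) (YZ _ Yp).
  have [Z /FP[_ injZ] [XZ YZ]] := chain_common Ftot FX FY.
  exact: injZ (XZ _ Xp) (YZ _ Yp).
have [totG|/existsNP[x nx]] := pselect (forall x, exists y, G (x, y)).
  have [f fP] := choice totG; left; exists f => x x' fxx'.
  by apply: injG (fP x) _; rewrite fxx'.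
have [surG|/existsNP[y ny]] := pselect (forall y, exists x, G (x, y)).
  have [f fP] := choice surG; right; exists f => y y' fyy'.
  by apply: funG (fP y) _; rewrite fyy'.
case: (nx); exists y; apply: (Gmax (G `|` [set (x, y)])); [by left| |by right].
split=> [a b b'|a a' b] [Gab|[ea eb]] [Gab'|[ea' eb']].
- exact: funG Gab Gab'.
- by case: nx; exists b; rewrite -ea'.
- by case: nx; exists b'; rewrite -ea.
- by rewrite eb eb'.
- exact: injG Gab Gab'.
- by case: ny; exists a; rewrite -eb'.
- by case: ny; exists a'; rewrite -eb.
- by rewrite ea ea'.
Qed.

Section Square.
Context (T : Type).

Local Notation dom G := [set x | exists z : T, G (x, x, z)].

Let idempotent_graph (G : set (T * T * T)) :=
  [/\ forall x y z, G (x, y, z) -> [/\ dom G x, dom G y & dom G z],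
      forall x y, dom G x -> dom G y -> exists z, G (x, y, z),
      forall p z z', G (p, z) -> G (p, z') -> z = z' &
      forall p p' z, G (p, z) -> G (p', z) -> p = p'].

Let idempotent_graph_bigcup (F : set (set (T * T * T))) :
  F `<=` idempotent_graph -> total_on F subset ->
  idempotent_graph (\bigcup_(X in F) X).
Proof.
move=> FP Ftot; split.
- move=> x y z [X FX Xp]; have [X1 _ _ _] := FP _ FX.
  by have [[u xu] [v yv] [w zw]] := X1 _ _ _ Xp; split; [exists u|exists v|exists w];
    exists X.
- move=> x y [u [X FX Xp]] [v [Y FY Yp]].
  have [Z FZ [XZ YZ]] := chain_common Ftot FX FY.
  have [_ Z2 _ _] := FP _ FZ.
  have [||z Zz] := Z2 x y; first by exists u; exact: XZ.
    by exists v; exact: YZ.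
  by exists z, Z.
- move=> p z z' [X FX Xp] [Y FY Yp].
  have [Z /FP[_ _ Z3 _] [XZ YZ]] := chain_common Ftot FX FY.
  exact: Z3 (XZ _ Xp) (YZ _ Yp).
- move=> p p' z [X FX Xp] [Y FY Yp].
  have [Z /FP[_ _ _ Z4] [XZ YZ]] := chain_common Ftot FX FY.
  exact: Z4 (XZ _ Xp) (YZ _ Yp).
Qed.

Let graph_of (S : Type) (v : S -> T) (F : S * S -> S) : set (T * T * T) :=
  [set p | exists a b, p = (v a, v b, v (F (a, b)))].

Let graph_of_idempotent (S : Type) (v : S -> T) (F : S * S -> S) :
  injective v -> injective F -> idempotent_graph (graph_of v F).
Proof.
move=> injv injF; have domE x : dom (graph_of v F) x <-> exists a, x = v a.
  split=> [[z [a [b [-> _ _]]]]|[a ->]]; first by exists a.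
  by exists (v (F (a, a))), a, a.
split.
- by move=> x y z [a [b [-> -> ->]]]; split; apply/domE; eexists.
- move=> x y /domE[a ->] /domE[b ->]; exists (v (F (a, b))).
  by exists a, b.
- by move=> p z z' [a [b [-> ->]]] [a' [b' [/injv <- /injv <- ->]]].
- by move=> p p' z [a [b [-> ->]]] [a' [b' [-> /injv/injF[<- <-]]]].
Qed.

(** Zorn's lemma gives a maximal [D] with an injection [f] of [D * D] into
[D]. If the complement of [D] embeds in [D], then [T] embeds in [D * D] and we
are done. Otherwise a copy [g @` D] of [D] lies in the complement and has room
for the new pairs of [(D + D) * (D + D)]: there are only three times as many as
there are elements in [D * D], so [f] would not be maximal. *)
Lemma embeds_square : embeds nat T -> embeds (T * T) T.
Proof.
move=> [e inje]; have [c injc] : embeds (nat * nat) nat.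
  by exists pickle; exact: pcan_inj pickleK.
pose P G := idempotent_graph G /\ graph_of e c `<=` G.
have [|F [X FX] FP Ftot|G [[[G1 G2 G3 G4] G0G] Gmax]] :=
    @zorn_set _ P (graph_of e c).
- by split=> //; exact: graph_of_idempotent.
- split; first by apply: idempotent_graph_bigcup => // Y /FP[].
  by apply: (subset_trans (proj2 (FP _ FX))) => p Xp; exists X.
pose D := {x : T | dom G x}.
have [f fP] : exists f : D * D -> D,
    forall p, G (sval p.1, sval p.2, sval (f p)).
  have [|f fP] := @choice (D * D) D
      (fun p z => G (sval p.1, sval p.2, sval z)); last by exists f.
  move=> [[x Dx] [y Dy]] /=; have [z Gz] := G2 _ _ Dx Dy.
  by have [_ _ Dz] := G1 _ _ _ Gz; exists (exist _ z Dz).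
have svalI : injective (sval : D -> T).
  by move=> [x Dx] [y Dy] /= xy; exact: eq_exist.
have injf : injective f.
  move=> [x y] [x' y'] fE; have := fP (x', y'); rewrite -fE.
  by move=> /(G4 _ _ _ (fP (x, y)))[/svalI -> /svalI ->].
have De n : dom G (e n) by exists (e (c (n, n))); apply: G0G; exists n, n.
pose eD n : D := exist _ (e n) (De n).
have [[g injg]|[g injg]] := embeds_total {x : T | ~ dom G x} D.
  have [h injh] : embeds T D.
    exists (fun x => match pselect (dom G x) with
      | left Dx => f (eD 0, exist _ x Dx)
      | right nDx => f (eD 1, g (exist _ x nDx)) end).
    move=> x y; case: pselect => [Dx|nDx]; case: pselect => [Dy|nDy] /injf.
    + by move=> [].
    + by move=> [] /inje.
    + by move=> [] /inje.
    + by move=> [] /injg[].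
  exists (sval \o f \o (fun p => (h p.1, h p.2))) => -[x y] [x' y'] /=.
  by move=> /svalI/injf[/injh -> /injh ->].
pose v (a : D + D) := match a with inl d => sval d | inr d => sval (g d) end.
have injv : injective v.
  move=> [a|a] [b|b] /= ab.
  - by rewrite (svalI _ _ ab).
  - by case: (svalP (g b)); rewrite -ab; exact: svalP.
  - by case: (svalP (g a)); rewrite ab; exact: svalP.
  - by congr inr; apply: injg; case: (g a) (g b) ab => [x nx] [y ny] /= xy;
      exact: eq_exist.
pose u (a : D + D) := match a with inl d => d | inr d => d end.
pose side (a : D + D) : nat := if a is inl _ then 0 else 1.
pose w a b := f (f (eD (side a), eD (side b)), f (u a, u b)).
have injw a b a' b' : w a b = w a' b' -> a = a' /\ b = b'.
  move=> /injf[/injf[/inje ia /inje ib] /injf[ua ub]].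
  by case: a a' b b' ia ib ua ub => [a|a] [a'|a'] [b|b] [b'|b'] //= _ _ -> ->.
pose k (p : (D + D) * (D + D)) : D + D := match p with
  | (inl x, inl y) => inl (f (x, y)) | (a, b) => inr (w a b) end.
have injk : injective k.
  move=> [[a|a] [b|b]] [[a'|a'] [b'|b']] //= [];
    by [move=> /injf[-> ->] | move=> /injw[-> ->]].
have Gk : G `<=` graph_of v k.
  move=> [[x y] z] Gp; have [Dx Dy _] := G1 _ _ _ Gp.
  exists (inl (exist _ x Dx)), (inl (exist _ y Dy)).
  by congr (_, _); exact: G3 Gp (fP (exist _ x Dx, exist _ y Dy)).
have Pk : P (graph_of v k).
  by split; [exact: graph_of_idempotent | exact: subset_trans G0G Gk].
pose a : D + D := inr (eD 0).
have /G1[Da _ _] : G (v a, v a, v (k (a, a))).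
  by apply: (Gmax _ Gk Pk); exists a, a.
by case: (svalP (g (eD 0))).
Qed.

End Square.

(** ** Small sets *)

(** The sets of size at most [K]. Coverings are stable under images and unions
without any choice of injections, and the option lets them cover the empty set. *)
Definition small (K T : Type) (A : set T) :=
  exists c : K -> option T, forall t, A t -> exists k, c k = Some t.

Lemma small_sub K T (A B : set T) : A `<=` B -> small K B -> small K A.
Proof. by move=> AB [c cP]; exists c => t /AB/cP. Qed.

Lemma small_image K T U (f : T -> U) (A : set T) :
  small K A -> small K (f @` A).
Proof.
move=> [c cP]; exists (omap f \o c) => _ [t /cP[k ck] <-].
by exists k; rewrite /= ck.
Qed.

Lemma small_bigcup K T (I : Type) (A : I -> set T) : embeds (K * K) K ->
  embeds I K -> (forall i, small K (A i)) -> small K (\bigcup_i A i).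
Proof.
move=> KK IK /choice[c cP].
have [p injp] : embeds (I * K) K.
  by apply: embeds_trans KK; apply: embeds_prod => //; exists id.
have [q qK] := partial_inverse injp.
exists (fun k => if q k is Some (i, l) then c i l else None).
by move=> t [i _ /cP[k ck]]; exists (p (i, k)); rewrite qK.
Qed.

Lemma small1 K T (t : T) : embeds nat K -> small K [set t].
Proof. by move=> [e _]; exists (fun=> Some t) => _ ->; exists (e 0). Qed.

Lemma smallU K T (A B : set T) : embeds nat K -> embeds (K * K) K ->
  small K A -> small K B -> small K (A `|` B).
Proof.
move=> [e inje] KK smA smB.
apply: (@small_sub _ _ _ (\bigcup_b (if b then A else B))).
  by move=> t [At|Bt]; [exists true|exists false].
apply: small_bigcup => //; last by case.
by exists (fun b : bool => e b) => -[] [] // /inje.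
Qed.

(** There are at most [L] sets in [P]; applied to the graphs of functions, this
bounds the number of functions with supports of a given size. *)
Definition codes (L : Type) (P : set (set L)) :=
  exists h : set L -> L, {in P &, injective h}.

(** A set of size at most [K] is the range of a partial map
from [K], and there are [L ^ K = L] of these. *)
Lemma small_codes K L : embeds nat L -> embeds (K -> L) L ->
  codes (@small K L).
Proof.
move=> [e inje] KL; have [p injp] := embeds_square (ex_intro _ e inje).
have [h injh] : embeds (K -> option L) L.
  apply: embeds_trans KL; apply: embeds_fun.
  exists (fun o => if o is Some l then p (e 1, l) else p (e 0, e 0)).
  move=> [x|] [y|] // /injp[] => [xy|/inje//|/inje//].
  by rewrite xy.
have [|c cP] := @choice (set L) (K -> option L)
    (fun A c => small K A -> forall t, A t <-> exists k, c k = Some t).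
  move=> A; have [[c cA]|nA] := pselect (small K A); last by exists (fun=> None).
  exists (fun k => if c k is Some t then
    if `[< A t >] then Some t else None else None) => _ t; split.
    by move=> At; have [k ck] := cA _ At; exists k; rewrite ck asboolT.
  by move=> [k]; case: (c k) => // s; case: asboolP => // As [<-].
exists (h \o c) => A B /set_mem smA /set_mem smB /injh cAB; apply/seteqP.
by split=> t; rewrite (cP A smA) (cP B smB) cAB.
Qed.

(** Pairing encodes finite sequences of a given length; the length itself is
recorded by a further pairing. *)
Lemma finite_codes L : embeds nat L -> codes (@finite_set L).
Proof.
move=> [e inje]; have [p injp] := embeds_square (ex_intro _ e inje).
pose fold := foldr (fun x y => p (x, y)) (e 0).
have inj_fold s t : size s = size t -> fold s = fold t -> s = t.
  elim: s t => [|x s IHs] [|y t] //= [st] /injp[-> /IHs->//].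
pose code s := p (e (size s), fold s).
have injcode : injective code by move=> s t /injp[/inje/inj_fold]; exact.
have [|c cP] := @choice (set L) (seq {classic L})
    (fun A s => finite_set A -> A = [set` s]).
  move=> A; have [/(@finite_seqP {classic L})[s As]|] := pselect (finite_set A).
    by exists s.
  by exists [::].
exists (code \o c) => A B /set_mem finA /set_mem finB /injcode cAB.
by rewrite (cP A finA) (cP B finB) cAB.
Qed.

Lemma embeds_exponent (K X : Type) : embeds (K * K) K ->
  embeds (K -> (K -> X)) (K -> X).
Proof.
move=> [p injp]; have [q qK] := partial_inverse injp.
have [[x]|noX] := pselect (inhabited X); last first.
  exists (fun h k => h k k) => h h' _; apply/funext => k; apply/funext => l.
  by case: noX; exists; exact: h k l.
exists (fun h k => if q k is Some (a, b) then h a b else x) => h h' hh'.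
apply/funext => a; apply/funext => b.
by have := congr1 (@^~ (p (a, b))) hh'; rewrite qK.
Qed.

(** ** Well-orders without small cofinal sets *)

Section WellOrder.
Context (T : Type) (r : rel T) (wo_r : well_order r).

Lemma wo_min (A : set T) t : A t -> exists m, A m /\ forall s, A s -> r m s.
Proof.
move=> At; have [|m [[mA mP] _]] := @wo_r (fun s => `[< A s >]).
  by exists t; apply/asboolP.
by exists m; split=> [|s As]; [exact/asboolP|apply: mP; exact/asboolP].
Qed.

Lemma wo_total s t : r s t \/ r t s.
Proof.
have [|m [[->|->] mP]] := @wo_min [set x | x = s \/ x = t] s; first by left.
  by left; apply: mP; right.
by right; apply: mP; left.
Qed.

Lemma wo_refl t : r t t. Proof. by case: (wo_total t t). Qed.

Lemma wo_anti s t : r s t -> r t s -> s = t.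
Proof.
move=> rst rts; have [|m [mA mP]] := @wo_r (fun x => `[< x = s \/ x = t >]).
  by exists s; apply/asboolP; left.
have minE x : x = s \/ x = t -> m = x.
  move=> xst; apply: mP; split; first exact/asboolP.
  by move=> y /asboolP; case: xst => -> [->|->] //; exact: wo_refl.
by rewrite -(minE s) ?(minE t) //; auto.
Qed.

Lemma wo_trans s t u : r s t -> r t u -> r s u.
Proof.
move=> rst rtu.
have [|m [mA mP]] := @wo_min [set x | [\/ x = s, x = t | x = u]] s.
  exact: Or31.
case: mA mP => -> mP; first by apply: mP; exact: Or33.
  by rewrite (wo_anti rst) //; apply: mP; exact: Or31.
by rewrite -(@wo_anti t u) //; apply: mP; exact: Or32.
Qed.

Lemma wo_nle s t : ~ r s t -> olt r t s.
Proof.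
move=> nst; have [//|rts] := wo_total s t; split=> // ts.
by apply: nst; rewrite ts; exact: wo_refl.
Qed.

Lemma wo_succ s t : olt r s t -> exists u, is_succ r s u.
Proof.
by move=> st; have [u [su uP]] := @wo_min [set u | olt r s u] t st; exists u.
Qed.

End WellOrder.

Lemma cantor (K : Type) : ~ small K [set: K -> bool].
Proof.
move=> [c cP].
pose d0 k := if c k is Some d then ~~ d k else true.
have [k ck] := cP d0 I.
have : d0 k = ~~ d0 k by rewrite {1}/d0 ck.
by case: (d0 k).
Qed.

(** The elements of a well-ordered power set of [K] with at most [K]
predecessors form an initial segment. It is not itself of size [K], because
otherwise the least element outside would belong to it; so it plays the role of
the successor cardinal of [K]. *)
Lemma long_order (K : Type) : embeds nat K -> exists (I : Type) (r : rel I),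
  [/\ limit_order r, embeds I (K -> bool),
    forall i, small K [set j | r j i] &
    forall b : K -> I, exists i, forall k, r (b k) i].
Proof.
move=> infK; have KK := embeds_square infK.
pose T := K -> bool.
have [r wo_r] := @well_ordering_principle {classic T}.
pose init : set T := [set t | small K [set s | r s t]].
have init_large : ~ small K init.
  move=> sm_init; have /existsNP[t nt] : ~ forall t, init t.
    by move=> allT; apply: (@cantor K); apply: small_sub sm_init => t _; exact: allT.
  have [m [nm mP]] := @wo_min _ _ wo_r [set t | ~ init t] t nt.
  apply: nm; apply: (@small_sub _ _ _ (init `|` [set m])).
    move=> s rsm; have [si|ns] := pselect (init s); [by left|right].
    exact: (wo_anti wo_r rsm (mP _ ns)).
  by apply: smallU => //; exact: small1.
pose I := {t : T | init t}.
pose rI : rel I := fun i j => r (sval i) (sval j).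
have svalI : injective (sval : I -> T).
  by move=> [x Dx] [y Dy] /= xy; exact: eq_exist.
have bounded (b : K -> I) : exists i, forall k, rI (b k) i.
  apply: contrapT => nb; apply: init_large.
  apply: (@small_sub _ _ _ (\bigcup_k [set s | r s (sval (b k))])).
    move=> s Is; apply: contrapT => ns; apply: nb; exists (exist _ s Is) => k.
    have [|rsb] := wo_total wo_r (sval (b k)) s; first by [].
    by case: ns; exists k.
  by apply: small_bigcup => // [|k]; [exists id|exact: svalP (b k)].
have small_seg i : small K [set j | rI j i].
  have [c cP] := svalP i.
  exists (fun k => if c k is Some t then
    if pselect (init t) is left It then Some (exist _ t It) else None else None).
  move=> j /cP[k ck]; exists k; rewrite ck; case: pselect => [It|[]].
    by congr Some; exact: svalI.
  exact: svalP.
exists I, rI; split=> //; last by exists sval.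
split.
- apply: antisymmetric_well_order => [i j /andP[]|A [i Ai]].
    by move=> /(wo_anti wo_r)/[apply]/svalI.
  have [|m [[j Aj <-] mP]] :=
      @wo_min _ _ wo_r [set sval j | j in [set j | j \in A]] (sval i).
    by exists i.
  by exists j; split=> // k Ak; apply: mP; exists k.
- apply: contrapT => noI; apply: init_large.
  by exists (fun=> None) => t It; case: noI; exists; exists t.
- move=> i; apply: contrapT => noj; apply: init_large.
  apply: small_sub (svalP i) => t It; apply: contrapT => nti.
  apply: noj; exists (exist _ t It); have [rit nit] := wo_nle wo_r nti.
  by split=> // ei; apply: nit; rewrite ei.
Qed.

Lemma embeds_option (L T : Type) : embeds nat L -> embeds T L ->
  embeds (option T) L.
Proof.
move=> infL [f injf]; have [p injp] := embeds_square infL.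
have [e inje] := infL.
exists (fun o => if o is Some t then p (e 1, f t) else p (e 0, e 0)).
by move=> [x|] [y|] // /injp[] => [/injf ->//|/inje//|/inje//].
Qed.

(** * Functions with restricted supports *)

(** An extension of the partial map with values in the full product may be
truncated to the indices that occur in the supports of its values. *)
Lemma baer_truncate (R : nzRingType) (I : Type) (E : I -> lmodType R)
    (A : submodClosed (dprod E)) (H : set (R^o * submod A)) (T : set I) :
  (forall i, injective_module (E i)) -> is_submodule H -> functional H ->
  (forall f : dprod E, (forall i, ~ T i -> f i = 0) -> f \in A) ->
  (forall r d i, H (r, d) -> val d i != 0 -> T i) ->
  exists x : submod A, forall (r : R) n, H (r, n) -> n = r *: x.
Proof.
move=> injE subH funH TA HT.
pose H' := [set p : R^o * dprod E | exists n, H (p.1, n) /\ p.2 = val n].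
have [||g gP] := injective_extend (injective_dprod injE) (H := H').
- split=> [|a [r1 f1] [r2 f2] [m [/= Hm ->]] [n [/= Hn ->]]].
    by exists 0; split=> //; exact: (is_submodule0 subH).
  exists (a *: m + n); split; last by [].
  exact: (proj2 subH a _ _ Hm Hn).
- by move=> m [n [/= /funH -> ->]].
pose x : dprod E := fun i => if pselect (T i) then g 1 i else 0.
have xA : x \in A by apply: TA => i nTi; rewrite /x; case: pselect.
exists (Submod xA) => r n Hn; apply: val_inj.
apply: functional_extensionality_dep => i.
have gr : g r = val n by apply: gP; exists n.
rewrite -[RHS]/(r *: x i) /x; case: pselect => [Ti|nTi] /=.
  rewrite -gr -[in LHS](mulr1 r) -[r * 1]/(r *: (1 : R^o)) linearZ.
  by [].
rewrite scaler0; apply: contrapT => /eqP ni; exact: nTi (HT _ _ _ Hn ni).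
Qed.

Section Supported.
Context (R : nzRingType) (I : Type) (G : lmodType R).

Local Notation prodG := (dprod (fun _ : I => G)).

Definition supp (f : prodG) : set I := [set i | f i != 0].

Definition set_ideal (S : set (set I)) :=
  [/\ S set0, forall A B, A `<=` B -> S B -> S A &
      forall A B, S A -> S B -> S (A `|` B)].

Lemma dprodP (f g : prodG) : f =1 g -> f = g.
Proof. exact: functional_extensionality_dep. Qed.

Lemma dprodDE (f g : prodG) i : (f + g) i = f i + g i. Proof. by []. Qed.

Lemma dprodZE r (f : prodG) i : (r *: f) i = r *: f i. Proof. by []. Qed.

Lemma supported_submodule (S : set (set I)) : set_ideal S ->
  is_submodule [set f | S (supp f)].
Proof.
move=> [S0 Ssub SU]; split=> [|a f g Sf Sg].
  by apply: Ssub S0 => i; rewrite /supp /= eqxx.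
apply: (Ssub _ (supp f `|` supp g)); last exact: SU.
move=> i; rewrite /supp /= dprodDE dprodZE => fgi.
have [fi0|fi0] := eqVneq (f i) 0; last by left.
by right; move: fgi; rewrite fi0 scaler0 add0r.
Qed.

Definition supported (S : set (set I)) (idS : set_ideal S) : submodClosed prodG :=
  to_submod (supported_submodule idS).

Definition delta (i : I) (x : G) : prodG :=
  fun j => if pselect (j = i) then x else 0.

Lemma delta_eq i x : delta i x i = x.
Proof. by rewrite /delta; case: pselect => //= nii; case: (nii erefl). Qed.

Lemma delta_neq i j x : j <> i -> delta i x j = 0.
Proof. by move=> nji; rewrite /delta; case: pselect. Qed.

Lemma supp_delta i x : supp (delta i x) `<=` [set i].
Proof.
move=> j; rewrite /supp /= => dj; apply: contrapT => nji.
by move: dj; rewrite delta_neq // eqxx.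
Qed.

Lemma supported_mem S (idS : set_ideal S) (f : submod (supported idS)) :
  S (supp (val f)).
Proof. by case: f => f fS; have /asboolP := fS. Qed.

(** All the values of a map from a left ideal are supported on one set of [S],
the union of their supports. *)
Lemma supported_injective S (idS : set_ideal S) : injective_module G ->
  (forall A : R -> set I, (forall r, S (A r)) -> S (\bigcup_r A r)) ->
  injective_module (submod (supported idS)).
Proof.
move=> injG Scup; apply: baer => H subH funH.
have [S0 Ssub _] := idS.
pose A r := [set i | exists n, H (r, n) /\ val n i != 0].
have SA r : S (A r).
  have [[n Hn]|nH] := pselect (exists n, H (r, n)).
    apply: Ssub (supported_mem n) => i [m [Hm mi]].
    by rewrite /supp /= (functional_inj subH funH Hn Hm).
  by apply: Ssub S0 => i [n [Hn _]]; case: nH; exists n.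
apply: (@baer_truncate R I (fun=> G) _ H (\bigcup_r A r)) => //.
  move=> f fA; apply/asboolP; apply: Ssub (Scup _ SA) => i fi.
  by apply: contrapT => /fA f0; move: fi; rewrite /supp /= f0 eqxx.
by move=> r d i Hrd di; exists r => //; exists d.
Qed.

(** A function is determined by its graph over its support, a set of pairs that
is as small as the support. *)
Lemma embeds_supported S (idS : set_ideal S) (L : Type) (P : set (set L)) :
  embeds (I * G) L -> codes P ->
  (forall A (j : I -> L), S A -> P (j @` A)) -> embeds (submod (supported idS)) L.
Proof.
move=> [e inje] [h injh] SP.
pose graph (f : submod (supported idS)) := (fun i => e (i, val f i)) @` supp (val f).
have graph_sub f g : graph f = graph g ->
    forall i, val f i != 0 -> val f i = val g i.
  move=> fg i fi; have : graph f (e (i, val f i)) by exists i.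
  by rewrite fg => -[j _ /inje[-> /esym]].
exists (h \o graph) => f g /injh fg.
have {}fg : graph f = graph g.
  by apply: fg; rewrite inE; apply: SP; exact: supported_mem.
apply: val_inj; apply: dprodP => i.
have [fi|fi] := eqVneq (val f i) 0; last exact: graph_sub.
have [gi|gi] := eqVneq (val g i) 0; first by rewrite fi gi.
by rewrite (graph_sub g f).
Qed.

End Supported.

(** * Universal injective modules *)

Section Universal.
Context (R : nzRingType).

(** The last condition says that every quotient [P / A] embeds in [N]; kernels
stand for quotient modules throughout. *)
Definition universal_injective (L : Type) (N : lmodType R) :=
  [/\ injective_module N, [set: N] #= [set: L] &
    forall (P : lmodType R) (A : set P), embeds P L -> is_submodule A ->
      exists f : {linear P -> N}, forall p, f p = 0 <-> A p].

Context (L : Type) (S : set (set L)) (idS : set_ideal S).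
Hypothesis S1 : forall l, S [set l].

Let N : lmodType R := submod (@supported R L (cogen R) S idS).
Hypothesis injN : injective_module N.

Let delta_in l x : delta l x \in @supported R L (cogen R) S idS.
Proof.
apply/asboolP; have [_ Ssub _] := idS.
exact: Ssub (@supp_delta _ _ _ l x) (S1 l).
Qed.

Let dlt (l : L) (x : cogen R) : N := Submod (delta_in l x).

Let dltE l x : val (dlt l x) = delta l x. Proof. by []. Qed.

(** Label the points of [P] by the indices of [N]. A maximal partial map with
kernel [A] whose values vanish at the labels of the points outside its domain
extends to [P] by injectivity. If [y] were in the kernel of the extension but not in
[A], then no multiple of [y] outside [A] could lie in the domain, and the
coordinate labelled by [y] would be free to receive an element with
annihilator [{r | A (r *: y)}]. *)
Lemma kernel_map (P : lmodType R) (A : set P) : embeds P L -> is_submodule A ->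
  exists f : {linear P -> N}, forall p, f p = 0 <-> A p.
Proof.
move=> [lab injlab] subA.
pose Q (H : set (P * N)) := [/\ is_submodule H, functional H,
  forall p, H (p, 0) <-> A p &
  forall p n q, H (p, n) -> val n (lab q) != 0 -> exists m, H (q, m)].
have [|F [X FX] FQ Ftot|H [[subH funH kerH labH] Hmax]] :=
    @zorn_set _ Q [set p | A p.1 /\ p.2 = 0].
- split=> [|n []//|p|p n q [_ /= ->]]; last 2 first.
  + by split=> [[]|].
  + by rewrite eqxx.
  split=> [|a u v [Au u0] [Av v0]]; first by split=> //; exact: is_submodule0 subA.
  by split; [exact: (proj2 subA)|rewrite /= u0 v0 scaler0 addr0].
- split.
  + by apply: bigcup_submodule => // [|Y /FQ[]//]; exists X.
  + by move=> n [Y /FQ[_ funY _ _]]; exact: funY.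
  + move=> p; split=> [[Y /FQ[_ _ kerY _] /kerY//]|Ap].
    by exists X => //; have [_ _ kerX _] := FQ _ FX; apply/kerX.
  + move=> p n q [Y FY Ypn] nq; have [_ _ _ labY] := FQ _ FY.
    by have [m Ym] := labY _ _ _ Ypn nq; exists m, Y.
have [f fP] := injective_extend injN subH funH.
exists f => y; split=> [fy0|Ay]; last by apply: fP; apply/kerH.
apply: contrapT => nAy.
have ndom m : ~ H (y, m).
  move=> Hm; apply: nAy; apply/kerH.
  by have := fP _ _ Hm; rewrite fy0 => ->.
pose J : set R^o := [set r | A (r *: y)].
have subJ : is_submodule J.
  split=> [|a u v Ju Jv]; first by rewrite /J /= scale0r; exact: is_submodule0 subA.
  rewrite /J /= scalerDl -[a *: u]/(a * u) -scalerA.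
  exact: (proj2 subA a _ _ Ju Jv).
have [x annx] := cogen_annihilator subJ.
pose u := dlt (lab y) x.
have uy r : val (r *: u) (lab y) = r *: x.
  by rewrite -[LHS]/(r *: delta (lab y) x (lab y)) delta_eq.
have ruE r : A (r *: y) -> r *: u = 0.
  move=> Ary; apply: val_inj; apply: dprodP => l.
  rewrite -[LHS]/(r *: delta (lab y) x l).
  have [->|nl] := pselect (l = lab y); first by rewrite delta_eq; apply/annx.
  by rewrite delta_neq // scaler0.
apply: (ndom u); apply: (Hmax (adjoin H (y, u))); last exact: (adjoin_mem _ subH).
  exact: sub_adjoin.
split.
- exact: adjoin_submodule.
- apply: adjoin_functional => // r n Hrn.
  have n0 : n = 0 by rewrite -(fP _ _ Hrn) linearZ_LR /= fy0 scaler0.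
  by rewrite n0 in Hrn *; rewrite ruE //; apply/kerH.
- move=> p; split=> [[[b n] [r [Hbn pE]]]|Ap]; last first.
    by apply: sub_adjoin; apply/kerH.
  have -> : p = b + r *: y := congr1 fst pE.
  have n0 : 0 = n + r *: u := congr1 snd pE.
  have ny : val n (lab y) = 0.
    apply: contrapT => /eqP ny; have [m] := labH _ _ _ Hbn ny; exact: ndom.
  have Ary : A (r *: y).
    apply/annx; have := congr1 (fun k : N => val k (lab y)) n0.
    rewrite -[X in _ = X]/(val n (lab y) + val (r *: u) (lab y)).
    by rewrite ny add0r uy => <-.
  move: n0; rewrite ruE // addr0 => n0; rewrite -n0 in Hbn.
  by apply: (is_submoduleD subA) => //; apply/kerH.
- move=> p m q [[b n] [r [Hbn pE]]]; have -> : m = n + r *: u := congr1 snd pE.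
  move=> mq.
  have [->|nqy] := pselect (q = y); first by exists u; exact: (adjoin_mem _ subH).
  have [|k Hk] := labH _ _ q Hbn; last by exists k; exact: sub_adjoin.
  move: mq; rewrite -[val _ _]/(val n (lab q) + r *: delta (lab y) x (lab q)).
  by rewrite delta_neq ?scaler0 ?addr0 // => /injlab.
Qed.

Lemma supported_universal : embeds N L -> universal_injective L N.
Proof.
move=> NL; split=> //; last exact: kernel_map.
rewrite card_eq_le; apply/andP; split; apply/card_leTT => //.
have [|x annx] := @cogen_annihilator R [set 0].
  by split=> // a u v -> ->; rewrite scaler0 addr0.
have x0 : x != 0.
  apply/eqP => x0; have /annx/eqP : 1 *: x = 0 by rewrite x0 scaler0.
  by rewrite oner_eq0.
exists (fun l => dlt l x) => l l' /(congr1 (fun k : N => val k l)).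
rewrite !dltE delta_eq; have [//|nll'] := pselect (l = l').
by rewrite delta_neq // => /eqP; rewrite (negPf x0).
Qed.

End Universal.


(** * Limit models of bounded functions *)

Section LinearMaps.
Context (R : nzRingType).

Lemma linear_inj (P M : lmodType R) (f : {linear P -> M}) :
  (forall x, f x = 0 -> x = 0) -> injective f.
Proof.
move=> ker0 x y fxy; apply/eqP; rewrite -subr_eq0; apply/eqP/ker0.
by rewrite linearB fxy subrr.
Qed.

Lemma corestrict (P M : lmodType R) (A : submodClosed M) (f : {linear P -> M}) :
  (forall p, f p \in A) -> exists g : {linear P -> submod A},
  forall p, val (g p) = f p.
Proof.
move=> fA; have [|g gE] := @linear_of_fun R P (submod A) (fun p => Submod (fA p)).
  by move=> a u v; apply: val_inj; rewrite /= linearP.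
by exists g => p; rewrite gE.
Qed.

Lemma injective_submod_eq (M : lmodType R) (A B : submodClosed M) :
  A =i B -> injective_module (submod A) -> injective_module (submod B).
Proof.
move=> AB; have [b|s sE] := @corestrict (submod B) M A val.
  by rewrite AB; exact: valP.
have [a|p pE] := @corestrict (submod A) M B val; first by rewrite -AB; exact: valP.
by apply: (@injective_retract R _ _ s p) => b; apply: val_inj; rewrite pE; exact: sE.
Qed.

Lemma RMod_embedding (P M : lmodType R) (f : {linear P -> M}) :
  K_embedding (RMod_Emb R) f <-> injective f.
Proof. by split=> [[]|injf]. Qed.

End LinearMaps.

Section BoundedFunctions.
Context (R : nzRingType) (L : Type) (N : lmodType R).
Context (I : Type) (r : rel I).
Hypothesis ord_r : limit_order r.

Let wo_r : well_order r. Proof. by case: ord_r. Qed.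

(** The extra index [None] gives the size of [N] to the first member of the
chain, whose functions vanish at every [Some k]. *)
Definition below (j : I) : set (set (option I)) :=
  [set A | forall k, A (Some k) -> r k j].

Definition bounded : set (set (option I)) := [set A | exists j, below j A].

(** At a limit index [i] these are the sets bounded by some [j] less than [i],
not all the sets of indices less than [i]: this makes [bounded_chain]
continuous. *)
Definition bounded_under (i : I) : set (set (option I)) :=
  [set A | (forall k, ~ A (Some k)) \/ exists j, olt r j i /\ below j A].

Let belowS j A B : A `<=` B -> below j B -> below j A.
Proof. by move=> AB bB k /AB/bB. Qed.

Let below_le j j' A : r j j' -> below j A -> below j' A.
Proof. by move=> jj' bA k /bA kj; exact: wo_trans kj jj'. Qed.

Let belowU j j' A B : below j A -> below j' B ->
  below j (A `|` B) \/ below j' (A `|` B).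
Proof.
move=> bA bB; have [jj'|j'j] := wo_total wo_r j j'; [right|left].
  by move=> k [|/bB//]; exact: below_le jj' bA k.
by move=> k [/bA//|]; exact: below_le j'j bB k.
Qed.

Lemma bounded_ideal : set_ideal bounded.
Proof.
have [_ [i0] _] := ord_r; split; first by exists i0.
  by move=> A B AB [j /(belowS AB)]; exists j.
by move=> A B [j jA] [j' j'B]; have [] := belowU jA j'B; [exists j|exists j'].
Qed.

Lemma bounded_under_ideal i : set_ideal (bounded_under i).
Proof.
split; first by left=> k [].
  move=> A B AB [nB|[j [ji /(belowS AB)]]]; last by right; exists j.
  by left=> k /AB; exact: nB.
move=> A B [nA|[j [ji jA]]] [nB|[j' [j'i j'B]]].
- by left=> k [/nA|/nB].
- by right; exists j'; split=> // k [/nA//|]; exact: j'B.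
- by right; exists j; split=> // k [|/nB//]; exact: jA.
- by right; have [] := belowU jA j'B; [exists j|exists j'].
Qed.

Definition bounded_fun : lmodType R := submod (supported N bounded_ideal).

Local Notation M := bounded_fun.

Lemma bounded_chain_submodule i :
  is_submodule [set f : M | bounded_under i (supp (val f))].
Proof.
have [s0 sP] := supported_submodule N (bounded_under_ideal i).
by split=> [|a f g Sf Sg]; [exact: s0|exact: sP].
Qed.

Definition bounded_chain i : submodClosed M :=
  to_submod (bounded_chain_submodule i).

Local Notation S := bounded_chain.

Let memS i (f : M) : f \in S i <-> bounded_under i (supp (val f)).
Proof. by split=> /asboolP. Qed.

Let S_mono i j : r i j -> {subset S i <= S j}.
Proof.
move=> ij f /memS[nf|[k [[ki nki] kf]]]; apply/memS; [by left|right].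
exists k; split=> //; split; first exact: wo_trans ki ij.
by move=> kj; apply: nki; rewrite kj in ki *; exact: (wo_anti wo_r ki ij).
Qed.

Let ltS i j (f : M) : olt r j i -> below j (supp (val f)) -> f \in S i.
Proof. by move=> ji jf; apply/memS; right; exists j. Qed.

Let S_limit i : is_limit r i ->
  [set` S i] = \bigcup_(j in [set j | olt r j i]) [set` S j].
Proof.
move=> [[i0 i0i] nosucc]; apply/seteqP; split=> [f /memS|f [j [ji _]]]; last first.
  exact: S_mono.
move=> [nf|[j [ji jf]]]; first by exists i0 => //; apply/memS; left.
have [k /not_implyP[jk nik]] : exists k, ~ (olt r j k -> r i k).
  by apply/existsNP => jP; apply: (nosucc j).
by exists k; [exact: wo_nle|exact: ltS jk jf].
Qed.

Let S_cover : [set: M] = \bigcup_i [set` S i].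
Proof.
apply/seteqP; split=> // f _; have [j jf] := supported_mem f.
have [_ _ /(_ j)[i ji]] := ord_r.
by exists i => //; exact: ltS ji jf.
Qed.

Hypothesis univN : universal_injective L N.

Let injN : injective_module N. Proof. by case: univN. Qed.

Hypothesis S_embeds : forall i, embeds (submod (S i)) L.

(** An extension [P] of the [i]-th member is embedded by extending the
coordinates of that member to [P], and by using the next coordinate for the
quotient of [P] by that member. *)
Let S_universal i j : is_succ r i j -> universal_over (RMod_Emb R) (S i) (S j).
Proof.
move=> [ij _] P g /RMod_embedding injg /card_leTT PS.
have PL : embeds P L by exact: embeds_trans PS (S_embeds i).
pose coord (c : option I) : {linear submod (S i) -> N} :=
  @dproj R (option I) (fun=> N) c \o (val : {linear M -> _}) \o val.
have ext c := cid (injN (coord c) injg).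
have sub_g : is_submodule (range g).
  split=> [|a _ _ [x _ <-] [y _ <-]]; first by exists 0; rewrite ?linear0.
  by exists (a *: x + y); rewrite ?linearP.
have [_ _ /(_ P (range g) PL sub_g)[q qP]] := univN.
pose fam (c : option I) : {linear P -> N} := match c with
  | None => sval (ext None)
  | Some k => if pselect (k = i) then q else
      if r k i then sval (ext (Some k)) else GRing.null_fun N end.
have fam_below p : below i (supp (dprod_map fam p)).
  move=> k; rewrite /supp /= /dprod_map /=; case: pselect => [ki|nki] /=.
    by rewrite ki wo_refl.
  by case: (r k i) => //; rewrite eqxx.
have [p|h0 h0E] := corestrict (A := supported N bounded_ideal)
    (f := dprod_map fam).
  by apply/asboolP; exists i; exact: fam_below.
have [p|h hE] := corestrict (A := S j) (f := h0).
  by apply: (ltS ij); rewrite h0E; exact: fam_below.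
have h_ext a : val (h (g a)) = val a.
  apply: val_inj; apply: dprodP => c; rewrite hE h0E /dprod_map.
  have gE c' : sval (ext c') (g a) = val (val a) c' by exact: svalP (ext c') a.
  case: c => [k|]; rewrite /= /dprod_map /=; last exact: (gE None).
  have under k' : r i k' -> val (val a) (Some k') = 0.
    move=> ik'; apply: contrapT => /eqP ak'.
    have /memS[/(_ k')|[l [[li nli] la]]] := valP a; first exact.
    apply: nli; apply: (wo_anti wo_r li).
    exact: wo_trans ik' (la _ ak').
  case: pselect => [ki|nki] /=.
    by rewrite ki (under i) ?wo_refl //; apply/qP; exists a.
  have [ki|/negP/(wo_nle wo_r)[ik _]] := boolP (r k i); first exact: gE.
  by rewrite under.
exists h; split=> //; apply/RMod_embedding; apply: linear_inj => p hp0.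
have coord0 c : fam c p = 0.
  have := congr1 (fun x : submod (S j) => val (val x) c) hp0.
  by rewrite hE h0E.
have : q p = 0.
  by have := coord0 (Some i); rewrite /=; case: pselect => // nii; case: (nii erefl).
move=> /qP[a _ ap]; rewrite -ap; suff -> : a = 0 by rewrite linear0.
by apply: val_inj; rewrite -h_ext ap hp0.
Qed.

Let N_embeds i : embeds N (submod (S i)).
Proof.
have dS x : delta None x \in supported N bounded_ideal.
  have [_ [i0] _] := ord_r; apply/asboolP; exists i0 => k.
  by move=> /(@supp_delta _ _ _ _ _ _).
have dSi x : (Submod (dS x) : M) \in S i.
  by apply/memS; left=> k /(@supp_delta _ _ _ _ _ _).
exists (fun x => Submod (dSi x)) => x y.
move=> /(congr1 (fun f : submod (S i) => val (val f) None)) /=.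
by rewrite !delta_eq.
Qed.

Lemma bounded_limit_model : embeds nat L -> embeds I L ->
  limit_model (RMod_Emb R) L bounded_fun.
Proof.
move=> infL IL; split=> //; first exact/infinite_embeds.
exists I, r, S; split=> //; first exact/card_leTT.
split=> // i; split=> //.
have [_ NL _] := univN; rewrite card_eq_le; apply/andP; split.
  exact/card_leTT.
by rewrite -(card_le_eql NL); apply/card_leTT.
Qed.

End BoundedFunctions.

Lemma bounded_chain_embeds (R : nzRingType) (L : Type) (N : lmodType R)
    (I : Type) (r : rel I) (ord_r : limit_order r) (P : set (set L)) :
  embeds nat L -> embeds I L -> embeds N L -> codes P ->
  (forall i A (j : option I -> L), bounded_under r i A -> P (j @` A)) ->
  forall i, embeds (submod (bounded_chain N ord_r i)) L.
Proof.
move=> infL IL NL codesP SP i.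
apply: embeds_trans (@embeds_supported R _ N _ (bounded_under_ideal ord_r i) L P
  _ codesP (SP i)).
  have fS (f : submod (bounded_chain N ord_r i)) :
      val (val f) \in supported N (bounded_under_ideal ord_r i).
    by have /asboolP := valP f => fi; apply/asboolP.
  exists (fun f => Submod (fS f)) => f g /(congr1 val) /= fg.
  by do 2 apply: val_inj.
apply: embeds_trans (embeds_square infL); apply: embeds_prod => //.
exact: embeds_option.
Qed.


(** * Schroeder-Bernstein for injective modules *)

Section SchroederBernstein.
Context (R : nzRingType).

Lemma fin_suppP (E : nat -> lmodType R) (d : dprod E) :
  d \in @fin_supp R nat E <->
  exists b, forall n, (b <= n)%N -> d n = 0.
Proof.
split=> [/asboolP/finite_seqP[s ds]|[b db]].
  exists (\max_(n <- s) n.+1) => n sn; apply: contrapT => /eqP dn.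
  have ns : n \in s by have : [set i | d i != 0] n by []; rewrite ds.
  by move: sn; rewrite leqNgt (@leq_bigmax_seq _ s xpredT (fun n => n.+1) n ns).
apply/asboolP; apply: (sub_finite_set _ (finite_II b)) => n /= dn.
by rewrite ltnNge; apply: contra_neqN dn; exact: db.
Qed.

Context (A B : lmodType R) (f : {linear A -> B}) (g : {linear B -> A}).
Hypotheses (injA : injective_module A) (injB : injective_module B).
Hypotheses (inj_f : injective f) (inj_g : injective g).
Hypothesis inj_sum : forall C : lmodType R, injective_module C ->
  injective_module (direct_sum (fun _ : nat => C)).

(** Write [A = C + g B] with [C] the kernel of a retraction [p] of [g], and
[phi = g \o f]. The submodules [phi^n C] are independent, so that [sigma]
embeds the injective module [D = C + C + ...] in [A], and
[sigma D = C + phi (sigma D)]. Hence [f (sigma D)] has a complement [Y] in [B],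
[B = f (sigma D) + Y] and [A = C + g B = sigma D + g Y] are both isomorphic to
[D + Y], and [psi] below is the resulting isomorphism. *)
Lemma injective_schroeder_bernstein : isomorphic B A.
Proof.
have [p gK] := injective_section injB inj_g.
have subC : is_submodule [set a | p a = 0].
  split=> [|a u v /= pu pv]; first by rewrite /= linear0.
  by rewrite linearP pu pv scaler0 addr0.
pose C : lmodType R := submod (to_submod subC).
have pC (c : C) : p (val c) = 0 by have /asboolP := valP c.
have [|q1 q1E] := @linear_of_fun R A A (fun a => a - g (p a)).
  by move=> a u v; rewrite !linearP addrACA -scalerDr.
have [|q qE] := @corestrict R A A (to_submod subC) q1.
  by move=> a; apply/asboolP; rewrite /= q1E linearB gK subrr.
have injC : injective_module C.
  apply: (@injective_retract R C A val q) injA => c; apply: val_inj.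
  by rewrite qE q1E pC linear0 subr0.
pose D := direct_sum (fun _ : nat => C).
have injD : injective_module D := inj_sum injC.
pose F n (d : D) : A := iter n (g \o f) (val (val d n)).
have iterP n a u v : iter n (g \o f) (a *: u + v) =
    a *: iter n (g \o f) u + iter n (g \o f) v.
  by elim: n => //= n ->; rewrite !linearP.
have iter0 n : iter n (g \o f) 0 = 0.
  by elim: n => //= n ->; rewrite !linear0.
have boundD (d : D) : exists b, forall n, (b <= n)%N -> val d n = 0.
  by have /fin_suppP := valP d.
have sumE (d : D) b b' : (forall n, (b <= n)%N -> val d n = 0) -> (b <= b')%N ->
    \sum_(0 <= n < b) F n d = \sum_(0 <= n < b') F n d.
  move=> db bb'; rewrite (@big_cat_nat _ _ _ b 0 b') //=.
  rewrite [X in _ = _ + X]big_nat_cond [X in _ = _ + X]big1 ?addr0 // => n.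
  by rewrite andbT => /andP[bn _]; rewrite /F db // iter0.
have [s sP] : exists s : D -> A, forall (d : D) b,
    (forall n, (b <= n)%N -> val d n = 0) -> s d = \sum_(0 <= n < b) F n d.
  have [b bP] := choice boundD.
  exists (fun d => \sum_(0 <= n < b d) F n d) => d b' db'.
  have [bb'|/ltnW b'b] := leqP (b d) b'; first exact: sumE (bP d) bb'.
  exact/esym/sumE.
have [|sigma sigmaE] := @linear_of_fun R D A s.
  move=> a u v; have [b1 ub] := boundD u; have [b2 vb] := boundD v.
  have u0 n : (maxn b1 b2 <= n)%N -> val u n = 0.
    by rewrite geq_max => /andP[/ub].
  have v0 n : (maxn b1 b2 <= n)%N -> val v n = 0.
    by rewrite geq_max => /andP[_ /vb].
  have w0 n : (maxn b1 b2 <= n)%N -> val (a *: u + v) n = 0.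
    move=> bn; rewrite -[LHS]/(a *: val u n + val v n).
    by rewrite u0 // v0 // scaler0 addr0.
  rewrite (sP _ _ u0) (sP _ _ v0) (sP _ _ w0) scaler_sumr -big_split.
  by apply: eq_bigr => n _; exact: iterP.
have shift (d : D) : exists d' : D, forall n, val d' n = val d n.+1.
  have [b db] := boundD d.
  have dS : (fun n => val d n.+1) \in @fin_supp R nat (fun=> C).
    by apply/fin_suppP; exists b => n bn; apply: db; exact: leqW.
  by exists (Submod dS).
have cons (c : C) (d : D) : exists d' : D,
    val d' 0 = c /\ forall n, val d' n.+1 = val d n.
  have [b db] := boundD d.
  have dS : (fun n => if n is m.+1 then val d m else c) \in
      @fin_supp R nat (fun=> C).
    by apply/fin_suppP; exists b.+1 => -[|n] // bn; exact: db.
  by exists (Submod dS).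
have sigma_rec (d d' : D) : (forall n, val d' n = val d n.+1) ->
    sigma d = val (val d 0) + g (f (sigma d')).
  move=> dd'; have [b db] := boundD d'.
  have db1 n : (b.+1 <= n)%N -> val d n = 0.
    by case: n => // n bn; rewrite -dd' db.
  rewrite !sigmaE (sP _ _ db) (sP _ _ db1) big_nat_recl //.
  congr (_ + _); rewrite !linear_sum; apply: eq_bigr => n _.
  by rewrite /F /= dd'.
have p_sigma (d d' : D) : (forall n, val d' n = val d n.+1) ->
    p (sigma d) = f (sigma d').
  by move=> dd'; rewrite (sigma_rec d d') // linearD pC add0r gK.
have inj_sigma : injective sigma.
  apply: linear_inj => d sd0; apply: val_inj.
  suff coord0 n (e : D) : sigma e = 0 -> val e n = 0.
    by apply: functional_extensionality_dep => n; exact: coord0.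
  elim: n e => [|n IHn] e se0; have [e' ee'] := shift e.
    apply: val_inj; have := sigma_rec e e' ee'; rewrite se0 => /esym.
    by rewrite -(p_sigma e e') // se0 !linear0 addr0.
  rewrite -ee'; apply: IHn; apply: inj_f.
  by rewrite -(p_sigma e e') // se0 !linear0.
have [t tK] := injective_section (s := f \o sigma) injD (inj_comp inj_f inj_sigma).
have {}tK d : t (f (sigma d)) = d by exact: tK.
pose psi : {linear B -> A} :=
  (sigma \o t) \+ (g \o (idfun \- (f \o sigma \o t))).
have psiE b : psi b = sigma (t b) + g (b - f (sigma (t b))) by [].
have inj_psi : injective psi.
  apply: linear_inj => b; rewrite psiE => b0; have [d' dd'] := shift (t b).
  have pb : f (sigma d') + (b - f (sigma (t b))) = 0.
    have := congr1 p b0; rewrite [p (_ + _)]linearD gK (p_sigma _ d') //.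
    by rewrite linear0.
  have d'0 : d' = 0.
    have := congr1 t pb; rewrite linear0 linearD [t (_ - _)]linearB !tK.
    by rewrite subrr addr0.
  have bE : b - f (sigma (t b)) = 0 by move: pb; rewrite d'0 !linear0 add0r.
  move: b0; rewrite bE linear0 addr0 => sb0.
  by move: bE; rewrite sb0 linear0 subr0.
have surj_psi a : exists b, psi b = a.
  have pq : a = val (q a) + g (p a) by rewrite qE q1E subrK.
  have [d [d0 dS]] := cons (q a) (t (p a)).
  exists (f (sigma d) + (p a - f (sigma (t (p a))))).
  rewrite psiE [t _]linearD [t (_ - _)]linearB !tK subrr addr0.
  rewrite [X in g X]addrAC subrr add0r.
  rewrite (sigma_rec d (t (p a))) // d0 linearB [RHS]pq.
  by rewrite -addrA [X in _ + X]addrCA subrr addr0.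
have [psi' psiK] := choice surj_psi.
exists psi, psi' => // b; exact: inj_psi.
Qed.

End SchroederBernstein.

(** * Noetherian rings are superstable *)

Section Noetherian.
Context (R : nzRingType).

(** Take [x n] with annihilator [J n]. On the union of the [J n] the map
[r |-> (r *: x n)_n] takes values in the direct sum, hence is given by a single
element of the direct sum; where the latter has a zero coordinate, the chain
has stopped. *)
Lemma chain_stabilizes (J : nat -> set R^o) : left_noetherian R ->
  (forall n, is_submodule (J n)) ->
  (forall m n, (m <= n)%N -> J m `<=` J n) ->
  exists n, forall m, J m `<=` J n.
Proof.
move=> noethR subJ incJ.
have [x annx] := choice (fun n => cogen_annihilator (subJ n)).
pose D := direct_sum (fun _ : nat => cogen R).
have injD : injective_module D by apply: noethR => _; exact: cogen_injective.
pose H := [set p : R^o * D |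
  (exists m, J m p.1) /\ forall n, val p.2 n = p.1 *: x n].
have [||g gP] := injective_extend injD (H := H).
- split=> [|a u v [[m Jm] um] [[n Jn] vn]].
    split; first by exists 0; exact: (is_submodule0 (subJ 0)).
    by move=> n; rewrite /= scale0r.
  split.
    exists (maxn m n); apply: (proj2 (subJ _)).
      exact: incJ (leq_maxl _ _) _ Jm.
    exact: incJ (leq_maxr _ _) _ Jn.
  move=> k; rewrite -[LHS]/(a *: val u.2 k + val v.2 k) um vn.
  by rewrite scalerA -scalerDl.
- move=> d [_ dn]; apply: val_inj; apply: functional_extensionality_dep => n.
  by rewrite dn scale0r.
have /fin_suppP[n zn] := valP (g 1).
exists n => m r Jr; apply/annx.
have dS : (fun k => r *: x k) \in @fin_supp R nat (fun=> cogen R).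
  by apply/fin_suppP; exists m => k mk; apply/annx; exact: incJ mk _ Jr.
have := gP r (Submod dS) (conj (ex_intro _ m Jr) (fun=> erefl)).
have -> : g r = r *: g 1 by rewrite -linearZ -[r *: 1]/(r * 1) mulr1.
move=> /(congr1 (fun d : D => val d n)) /= <-.
by rewrite -[LHS]/(r *: val (g 1) n) zn // scaler0.
Qed.

(** By Baer's criterion: since chains of left ideals stabilize, a map from a left
ideal to the union takes its values in one member [S i]. An injective module of
size [L] containing [S i] provides the required element; it can be found in the
union because the next member is universal over [S i]. *)
Lemma limit_model_injective (L : Type) (N M : lmodType R) :
  left_noetherian R -> universal_injective L N ->
  limit_model (RMod_Emb R) L M -> injective_module M.
Proof.
move=> noethR [injN NL kerN] [_ _ [I [r [S [ord_r IL [SL Smono _ Scover Suniv]]]]]].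
have [wo_r [i0] nomax] := ord_r.
have cover m : exists i, m \in S i.
  have : [set: M] m by []; rewrite Scover => -[i _ mi]; by exists i.
apply: baer => H subH funH.
have [i Hi] : exists i, forall p, H p -> p.2 \in S i.
  apply: contrapT => noi.
  (* Otherwise the values leave [S i] for some later [S j], for every [i], and
  the left ideals on which the values lie in [S (u n)] increase strictly. *)
  have next i : exists j, exists p, [/\ H p, p.2 \notin S i & p.2 \in S j].
    have /existsNP[p /not_implyP[Hp pi]] : ~ forall p, H p -> p.2 \in S i.
      by move=> Hi; apply: noi; exists i.
    by have [j pj] := cover p.2; exists j, p; split=> //; exact/negP.
  have [next' nextP] := choice next.
  have next_le i : r i (next' i).
    have [//|ni] := wo_total wo_r i (next' i).
    have [p [_ /negP npi pj]] := nextP i; case: npi.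
    exact: Smono ni _ pj.
  pose u n := iter n next' i0.
  have u_le m n : (m <= n)%N -> r (u m) (u n).
    elim: n => [|n IHn]; first by rewrite leqn0 => /eqP ->; exact: wo_refl.
    rewrite leq_eqVlt => /orP[/eqP ->|/IHn mn]; first exact: wo_refl.
    exact: wo_trans mn (next_le _).
  pose J n := [set s : R^o | exists m, H (s, m) /\ m \in S (u n)].
  have [n|m n mn s [m' [Hm' mS]]|n stable] := @chain_stabilizes J noethR.
  - split=> [|a s t [m [Hm mS]] [k [Hk kS]]].
      by exists 0; split; [exact: (is_submodule0 subH)|exact: rpred0].
    exists (a *: m + k); split; first exact: (proj2 subH a _ _ Hm Hk).
    by rewrite rpredD // rpredZ.
  - by exists m'; split=> //; exact: Smono (u_le _ _ mn) _ mS.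
  have [[s m] [Hm /negP nm mS]] := nextP (u n); apply: nm.
  have [k [Hk kS]] : J n s by apply: (stable n.+1); exists m.
  by rewrite (functional_inj subH funH Hm Hk).
have [k ik] : exists k, is_succ r i k.
  by have [j' ij'] := nomax i; exact: wo_succ ij'.
have [||e eP] := kerN (submod (S i)) [set 0].
- by have [_ SiL] := SL i; apply/card_leTT; rewrite (card_le_eql SiL).
- by split=> // a u v -> ->; rewrite scaler0 addr0.
have inj_e : injective e by apply: linear_inj => a /eP.
have [||h [_ hP]] := Suniv i k ik N e.
- exact/RMod_embedding.
- by have [_ SiL] := SL i; rewrite (card_le_eql NL) (card_le_eqr SiL).
pose H' := [set p : R^o * N | exists a : submod (S i), H (p.1, val a) /\ p.2 = e a].
have [||g gP] := injective_extend injN (H := H').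
- split=> [|a [r1 n1] [r2 n2] [m1 [/= H1 ->]] [m2 [/= H2 ->]]].
    exists 0; split; last by rewrite /= linear0.
    exact: (is_submodule0 subH).
  exists (a *: m1 + m2); split; last by rewrite /= linearP.
  exact: (proj2 subH a _ _ H1 H2).
- move=> n [a [/= Ha ->]]; have -> : a = 0 by apply: val_inj; exact: funH Ha.
  by rewrite linear0.
exists (val (h (g 1))) => s m Hm.
pose a : submod (S i) := Submod (Hi _ Hm).
have ga : g s = e a by apply: gP; exists a.
rewrite -[m]/(val a) -hP -ga.
have -> : g s = s *: g 1 by rewrite -linearZ -[s *: 1]/(s * 1) mulr1.
by rewrite linearZ.
Qed.

Lemma limit_model_embeds (L : Type) (M : lmodType R) :
  limit_model (RMod_Emb R) L M -> embeds M L.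
Proof.
move=> [/infinite_embeds infL _ [I [r [S [_ /card_leTT IL [SL _ _ Scover _]]]]]].
apply: embeds_trans (embeds_square infL).
apply: (@embeds_trans _ (I * L)); last by apply: embeds_prod => //; exists id.
have SL' i : embeds (submod (S i)) L.
  by have [_ SiL] := SL i; apply/card_leTT; rewrite (card_le_eql SiL).
have e i := cid (SL' i).
have cover m : exists i, m \in S i.
  have : [set: M] m by []; rewrite Scover => -[i _ mi]; by exists i.
have [c cP] := choice cover.
exists (fun m => (c m, sval (e (c m)) (Submod (cP m)))) => m m' [cE].
by move: (cP m) (cP m'); rewrite cE => Sm Sm' /(svalP (e (c m')))[].
Qed.

(** Every module of size at most [L] embeds in a limit model: embed its direct
sum with a member of the chain in the next member. *)
Lemma limit_model_universal (L : Type) (M P : lmodType R) :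
  limit_model (RMod_Emb R) L M -> embeds P L ->
  exists f : {linear P -> M}, injective f.
Proof.
move=> [/infinite_embeds infL _ [I [r [S [ord_r _ [SL _ _ _ Suniv]]]]]] PL.
have [wo_r [i] nomax] := ord_r.
have [k ik] : exists k, is_succ r i k.
  by have [j' ij'] := nomax i; exact: wo_succ ij'.
have [_ SiL] := SL i.
have [|g gE] := @linear_of_fun R (submod (S i)) (submod (S i) * P)%type
    (fun a => (a, 0)).
  by move=> a u v; congr (_, _); rewrite /= scaler0 addr0.
have [||h [/RMod_embedding injh _]] := Suniv i k ik _ g.
- by apply/RMod_embedding => a b; rewrite !gE => -[].
- rewrite (card_le_eqr SiL); apply/card_leTT.
  apply: embeds_trans (embeds_square infL); apply: embeds_prod => //.
  by apply/card_leTT; rewrite (card_le_eql SiL).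
have [|f fE] := @linear_of_fun R P M (fun p => val (h (0, p))).
  move=> a u v; rewrite -linearP -linearP; congr (val (h _)).
  by congr (_, _); rewrite /= scaler0 addr0.
by exists f => x y; rewrite !fE => /val_inj/injh[].
Qed.

Lemma order_nat : limit_order leq.
Proof.
split; [|exact: (inhabits 0)|by move=> n; exists n.+1; split=> //; exact/n_Sn].
apply: antisymmetric_well_order => [m n|A [n An]]; first exact: anti_leq.
by case: (ex_minnP (ex_intro _ n An)) => m Am mP; exists m; split.
Qed.

Lemma nat_limit_model (L : Type) (N : lmodType R) :
  embeds nat L -> universal_injective L N ->
  limit_model (RMod_Emb R) L (bounded_fun N order_nat).
Proof.
move=> infL univN; apply: bounded_limit_model => //.
apply: (@bounded_chain_embeds R L N nat leq order_nat (@finite_set L)) => //.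
- by have [_ NL _] := univN; apply/card_leTT; rewrite (card_le_eql NL).
- exact: finite_codes.
move=> i A j bA; apply: finite_image.
apply: (@sub_finite_set _ _ (None |` (Some @` `I_i.+1))).
  move=> [k Ak|_]; last by left.
  right; exists k => //=; case: bA => [/(_ k)//|[l [[li _] lA]]].
  by rewrite ltnS (leq_trans (lA _ Ak)).
by rewrite finite_setU; split; [exact: finite_set1|exact/finite_image/finite_II].
Qed.

(** The direct sum [N] of [L] copies of [cogen R] is injective because [R] is
noetherian, so it is a universal injective module of size [L] and the finite
functions from [nat] to [N] form a limit model. Any two limit models are
injective and embed in each other, hence are isomorphic. *)
Lemma noetherian_superstable : left_noetherian R -> superstable (RMod_Emb R).
Proof.
(* [cogen R] has at most [L] elements, so [N] below has size [L]. *)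
move=> noethR; exists ((R + nat) + cogen R)%type; split.
  by apply/card_leTT; exact: embeds_inl.
move=> L /card_leTT muL.
have infL : embeds nat L.
  apply: embeds_trans muL; apply: (@embeds_trans _ (R + nat)).
    exact: embeds_inr.
  exact: embeds_inl.
have GL : embeds (cogen R) L by apply: embeds_trans muL; exact: embeds_inr.
have fin_ideal T : set_ideal (@finite_set T).
  split=> [|A B AB|A B finA finB]; first exact: finite_set0.
    exact: sub_finite_set.
  by rewrite finite_setU.
pose N : lmodType R := submod (@supported R L (cogen R) _ (fin_ideal L)).
have injN : injective_module N.
  apply: (@injective_submod_eq R _ (@fin_supp R L (fun=> cogen R))) => //.
  by apply: noethR => _; exact: cogen_injective.
have NL : embeds N L.
  apply: (@embeds_supported R L (cogen R) _ (fin_ideal L) L (@finite_set L)).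
  - apply: embeds_trans (embeds_square infL); apply: embeds_prod => //.
    by exists id.
  - exact: finite_codes.
  - by move=> A j; exact: finite_image.
have univN : universal_injective L N.
  by apply: supported_universal => // l; exact: finite_set1.
split.
  by exists (bounded_fun N order_nat); exact: nat_limit_model.
move=> M M' limM limM'.
have injM := limit_model_injective noethR univN limM.
have injM' := limit_model_injective noethR univN limM'.
have [f injf] := limit_model_universal limM' (limit_model_embeds limM).
have [g injg] := limit_model_universal limM (limit_model_embeds limM').
apply: (injective_schroeder_bernstein injM' injM injg injf).
by move=> C injC; exact: noethR.
Qed.

End Noetherian.

(** * Superstability implies noetherianity *)

Section Superstable.
Context (R : nzRingType).

Lemma isomorphic_injective (M N : lmodType R) :
  isomorphic M N -> injective_module N -> injective_module M.
Proof.
move=> [f [g fK gK]] injN.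
have [|g' g'E] := @linear_of_fun R N M g; first exact: can2_linear fK gK.
by apply: (@injective_retract R M N f g') injN => x; rewrite g'E fK.
Qed.

(** Both the finite and the long bounded functions with values in [N] form a
limit model of size [L]. A map from a left ideal to the long bounded functions
has bounded image and therefore takes its values in a product of copies of [N],
so the long model is injective, hence so is the isomorphic short one. *)
Lemma short_limit_model_injective (K L : Type) (N : lmodType R) :
  embeds (R + nat) K -> embeds (K -> L) L -> embeds (K -> bool) L ->
  universal_injective L N ->
  (forall M M' : lmodType R, limit_model (RMod_Emb R) L M ->
     limit_model (RMod_Emb R) L M' -> isomorphic M M') ->
  injective_module (bounded_fun N order_nat).
Proof.
move=> RnK KL boolL univN uniq.
have infK : embeds nat K by apply: embeds_trans RnK; exact: embeds_inr.
have KK := embeds_square infK.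
have [rK injrK] : embeds R K by apply: embeds_trans RnK; exact: embeds_inl.
have infL : embeds nat L.
  apply: embeds_trans boolL; apply: embeds_trans infK _.
  exists (fun k l => `[< k = l >]) => k l /(congr1 (@^~ k)).
  by rewrite asboolT // => /esym/asboolP.
have [injN NL _] := univN.
have [I [r [ord_r IK segK boundK]]] := long_order infK.
have IL := embeds_trans IK boolL.
have limI : limit_model (RMod_Emb R) L (bounded_fun N ord_r).
  apply: bounded_limit_model => //.
  apply: (@bounded_chain_embeds R L N I r ord_r (@small K L)) => //.
  - by apply/card_leTT; rewrite (card_le_eql NL).
  - exact: small_codes.
  move=> i A j bA; apply: small_image.
  apply: (@small_sub _ _ _ ([set None] `|` (Some @` [set k | r k i]))).
    move=> [k Ak|_]; last by left.
    right; exists k => //=; case: bA => [/(_ k)//|[l [[li _] lA]]].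
    by have [wo_r _ _] := ord_r; exact: wo_trans (lA _ Ak) li.
  by apply: smallU => //; [exact: small1|exact: small_image].
apply: isomorphic_injective (uniq _ _ (nat_limit_model infL univN) limI) _.
apply: supported_injective => // A /choice[b bA].
have [q qK] := partial_inverse injrK.
have [i iP] := boundK (fun k => if q k is Some s then b s else b 0).
exists i => k [s _ As]; have [wo_r _ _] := ord_r.
apply: wo_trans (bA s k As) _ => //.
by have := iP (rK s); rewrite qK.
Qed.

(** The size [L] is chosen with [L ^ K = L], so that the [L]-indexed families
with support of size at most [K], where [K = R + nat], form a universal
injective module [N] of size [L]. A countable family of injective modules of
size at most [L] embeds termwise in [N], and its direct sum is then a retract
of the finite functions from [nat] to [N]. *)
Lemma countable_sum_injective (E : nat -> lmodType R) :
  superstable (RMod_Emb R) -> (forall n, injective_module (E n)) ->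
  injective_module (direct_sum E).
Proof.
move=> [mu [_ ss]] injE.
pose K := (R + nat)%type.
pose X := (mu + (cogen R + (nat + {n : nat & E n})))%type.
(* [X] is at least as large as [mu], [cogen R] and every [E n], and exponents in
[K] are absorbed by [L]. *)
pose L : cardinal := K -> X.
have infK : embeds nat K by exact: embeds_inr.
have KK := embeds_square infK.
have XL : embeds X L.
  exists (fun x _ => x) => x y /(congr1 (@^~ (inl 0))); exact.
have KL : embeds (K -> L) L by exact: embeds_exponent.
have natX : embeds nat X.
  apply: embeds_trans (embeds_inr _ _); apply: embeds_trans (embeds_inr _ _).
  exact: embeds_inl.
have infL := embeds_trans natX XL.
have boolL : embeds (K -> bool) L.
  apply: embeds_fun; apply: embeds_trans natX.
  by exists (fun b : bool => b : nat) => -[] [].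
have muL : embeds mu L by apply: embeds_trans XL; exact: embeds_inl.
have GL : embeds (cogen R) L.
  apply: embeds_trans XL; apply: embeds_trans (embeds_inr _ _).
  exact: embeds_inl.
have EL n : embeds (E n) L.
  apply: embeds_trans XL; apply: embeds_trans (embeds_inr _ _).
  apply: embeds_trans (embeds_inr _ _); apply: embeds_trans (embeds_inr _ _).
  by exists (existT (fun n => E n : Type) n) => x y; exact: eq_from_Tagged.
have idK : set_ideal (@small K L).
  split=> [|A B|A B]; [by exists (fun=> None)|exact: small_sub|exact: smallU].
pose N : lmodType R := submod (@supported R L (cogen R) _ idK).
have injN : injective_module N.
  apply: supported_injective => [|A]; first exact: cogen_injective.
  by apply: small_bigcup => //; exact: embeds_inl.
have NL : embeds N L.
  apply: (@embeds_supported R L (cogen R) _ idK L (@small K L)).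
  - apply: embeds_trans (embeds_square infL); apply: embeds_prod => //.
    by exists id.
  - exact: small_codes.
  - by move=> A j; exact: small_image.
have univN : universal_injective L N.
  by apply: supported_universal => // l; exact: small1.
have [_ uniq] : (exists M, limit_model (RMod_Emb R) L M) /\ _ :=
  ss L ((card_leTT _ _).2 muL).
have injM : injective_module (bounded_fun N order_nat).
  apply: (@short_limit_model_injective K L N) => //; by exists id.
have emb n : exists jp : {linear E n -> N} * {linear N -> E n},
    cancel jp.1 jp.2.
  have [_ _ /(_ (E n) [set 0] (EL n))[|j jP]] := univN.
    by split=> // a u v -> ->; rewrite scaler0 addr0.
  have [|p jK] := injective_section (s := j) (injE n).
    by apply: linear_inj => a /jP.
  by exists (j, p).
pose j n := (sval (cid (emb n))).1; pose p n := (sval (cid (emb n))).2.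
have jK n : cancel (j n) (p n) := svalP (cid (emb n)).
(* The index [None] of the limit model does not occur in [direct_sum E]. *)
pose fam (c : option nat) : {linear direct_sum E -> N} :=
  if c is Some n then j n \o (@dproj R nat E n \o val) else GRing.null_fun N.
have [d|s sE] := @corestrict R _ _ (supported N (bounded_ideal order_nat))
    (dprod_map fam).
  have /fin_suppP[b bd] := valP d; apply/asboolP; exists b => k.
  rewrite /supp /= /dprod_map /=; apply: contraR; rewrite -ltnNge => bk.
  by rewrite /dproj bd ?linear0 // ltnW.
have [f|q qE] := @corestrict R (bounded_fun N order_nat) _ (@fin_supp R nat E)
    (dprod_map (fun n => p n \o (@dproj R _ (fun=> N) (Some n) \o val))).
  apply/fin_suppP; have [b bf] := supported_mem f; exists b.+1 => n bn.
  suff fn : val f (Some n) = 0.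
    by rewrite -[LHS]/(p n (val f (Some n))) fn linear0.
  by apply: contrapT => /eqP fn; have := bf n fn; rewrite leqNgt bn.
apply: (@injective_retract R _ _ s q) injM => d; apply: val_inj.
apply: functional_extensionality_dep => n.
rewrite qE -[LHS]/(p n (val (s d) (Some n))).
have -> : val (s d) (Some n) = j n (val d n) by rewrite sE.
exact: jK.
Qed.

(** By Baer's criterion: if the values of a map from a left ideal to the direct
sum had nonzero coordinates at infinitely many indices, then the projection to
countably many of these indices could not extend to [R], whose generator has
an image with finite support. *)
Lemma superstable_noetherian : superstable (RMod_Emb R) -> left_noetherian R.
Proof.
move=> ss I E injE; apply: baer => H subH funH.
pose T := [set i | exists r d, H (r, d) /\ val d i != 0].
apply: (baer_truncate injE subH funH (T := T)) => [f fT|r d i Hd di]; last first.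
  by exists r, d.
apply/asboolP; apply: (@sub_finite_set _ _ T).
  by move=> i fi; apply: contrapT => /fT f0; move: fi; rewrite /= f0 eqxx.
(* [t] enumerates infinitely many of the indices that occur. *)
apply: contrapT => /infiniteP/card_leP[c].
pose t n : I := val (c (SigSub (in_setT n))).
have tT n : T (t n) by apply: set_mem; exact: valP.
have inj_t : injective t.
  move=> m n /val_inj cmn.
  have := 'inj_c (in_setT (SigSub (in_setT m))) (in_setT (SigSub (in_setT n))) cmn.
  by move=> /(congr1 val).
have injD := countable_sum_injective ss (fun n => injE (t n)).
pose H' := [set p : R^o * direct_sum (E \o t) | exists d,
  H (p.1, d) /\ forall n, val p.2 n = val d (t n)].
have [||g gP] := injective_extend injD (H := H').
- split=> [|a [r1 f1] [r2 f2] [m [/= Hm fm]] [n [/= Hn fn]]].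
    by exists 0; split=> //; exact: (is_submodule0 subH).
  exists (a *: m + n); split; first exact: (proj2 subH a _ _ Hm Hn).
  by move=> k; exact: (congr2 (fun u v => a *: u + v) (fm k) (fn k)).
- move=> m [d [/= /funH d0 md]]; apply: val_inj.
  by apply: functional_extensionality_dep => n; rewrite d0 in md; exact: md.
have /fin_suppP[b zb] := valP (g 1).
have [r [d [Hd /eqP]]] := tT b; apply.
have dt : (fun n => val d (t n)) \in @fin_supp R nat (E \o t).
  have /asboolP dfin := valP d; apply/asboolP.
  by apply: (@finite_preimage _ _ [set i | val d i != 0] t) => // m n _ _ /inj_t.
have gr : g r = Submod dt by apply: gP; exists d.
have <- : val (g r) b = val d (t b) by rewrite gr.
have -> : g r = r *: g 1 by rewrite -linearZ -[r *: 1]/(r * 1) mulr1.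
by rewrite -[LHS]/(r *: val (g 1) b) zb // scaler0.
Qed.

End Superstable.

Theorem corollary5p13 (R : nzRingType) :
  superstable (RMod_Emb R) <-> left_noetherian R.
Proof.
by split; [exact: superstable_noetherian | exact: noetherian_superstable].
Qed.
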